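(* Let $a>b>0$ and consider the magic billiard with half-turn about the center in the table bounded by the ellipse $\mathcal{E}:\ \frac{x^2}{a}+\frac{y^2}{b}=1$. Consider a trajectory of this billiard with caustic $\mathcal{C}_\beta$. Let $n$ be a positive integer. The trajectory is $n$-periodic if and only if: (i) $n$ is even and $$\left|\begin{array}{cccc} B_3 & B_4 & \dots & B_{n/2+1}\\ B_4 & B_5 & \dots & B_{n/2+2}\\ \dots\\ B_{n/2+1} & B_{n/2+2} & \dots & B_{n-1}\end{array}\right|=0;$$ or (ii) $n$ is odd and $$\left|\begin{array}{cccc} B_2 & B_3 & \dots & B_{(n+1)/2}\\ B_3 & B_4 & \dots & B_{(n+1)/2+1}\\ \dots\\ B_{(n+1)/2} & B_{(n+1)/2+1} & \dots & B_{n-1}\end{array}\right|=0.$$ Here $\sqrt{(a-x)(b-x)(\beta-x)}=B_0+B_1x+B_2x^2+\dots$ is the Taylor expansion around $x=0$.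
   Context: Confocal family: $\mathcal{C}_\lambda:\ \frac{x^2}{a-\lambda}+\frac{y^2}{b-\lambda}=1$, so $\mathcal{E}=\mathcal{C}_0$; $\mathcal{C}_\lambda$ is an ellipse for $\lambda<b$ and a hyperbola for $b<\lambda<a$. Magic billiard with half-turn about the center: let $D$ be the closed domain bounded by $\mathcal{E}$, and let $\varphi$ be the half-turn about the center of $\mathcal{E}$, $\varphi(x,y)=(-x,-y)$. A particle moves with unit speed along straight segments inside $D$. When it hits $\mathcal{E}$ at a point $A$ with velocity $\vec v$, it continues from the point $\varphi(A)$ with velocity $\varphi^*(\vec v)=d\varphi(\rho_A(\vec v))$, where $\rho_A$ is the usual billiard reflection (reflection of vectors with respect to the tangent line to $\mathcal{E}$ at $A$). Caustic: each trajectory has a unique conic $\mathcal{C}_\beta$ of the confocal family such that the lines containing the segments of the trajectory are all tangent to $\mathcal{C}_\beta$; it is called the caustic of the trajectory. The caustic is nondegenerate, i.e. $\beta\in(0,b)\cup(b,a)$. $n$-periodic: after $n$ consecutive hits at the boundary the particle returns to its initial position and velocity ($n$ is not required to be the minimal such number). The first determinant is of a Hankel matrix of size $n/2-1$, the second of a Hankel matrix of size $(n-1)/2$; an empty ($0\times0$) determinant equals $1$, so the corresponding condition then fails. The branch of the square root is the one positive at $x=0$. *)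

(* Defs.v *)
From HB Require Import structures.
From mathcomp Require Import all_boot all_order all_algebra.
From mathcomp Require Import all_classical all_reals all_analysis.

Set Implicit Arguments.
Unset Strict Implicit.
Unset Printing Implicit Defensive.

Import Order.TTheory GRing.Theory Num.Theory.
Import numFieldNormedType.Exports.

Local Open Scope ring_scope.

Definition dot {R : realType} (u v : R * R) : R := u.1 * v.1 + u.2 * v.2.

Definition on_ellipse {R : realType} (a b : R) (P : R * R) : Prop :=
  P.1 ^+ 2 / a + P.2 ^+ 2 / b = 1.

Definition in_table {R : realType} (a b : R) (P : R * R) : Prop :=
  P.1 ^+ 2 / a + P.2 ^+ 2 / b <= 1.

(* The gradient direction of x^2/a + y^2/b at A. *)
Definition ellipse_normal {R : realType} (a b : R) (A : R * R) : R * R :=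
  (A.1 / a, A.2 / b).

(* Reflection of the vector v in the tangent line to the ellipse at A. *)
Definition reflect_at {R : realType} (a b : R) (A v : R * R) : R * R :=
  let m := ellipse_normal a b A in v - (2 * (dot v m / dot m m)) *: m.

(* The half-turn is linear, so it is its own differential: the same map is
   applied to points and to velocities. *)
Definition half_turn {R : realType} (P : R * R) : R * R := - P.

(* For P in the table at most one t > 0 satisfies this, so Q is the first hit;
   if P lies on the ellipse, such a t exists only if v points strictly inside. *)
Definition hits {R : realType} (a b : R) (P v Q : R * R) : Prop :=
  exists t : R, [/\ 0 < t, Q = P + t *: v & on_ellipse a b Q].

(* P i and v i are the position and the velocity right after the i-th hit
   (including the half-turn); P 0 and v 0 are the initial data, and P 0 may be
   any point of the closed table. *)
Definition magic_trajectory {R : realType} (a b : R) (P v : nat -> R * R)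
    : Prop :=
  [/\ in_table a b (P 0), dot (v 0) (v 0) = 1 &
      forall i : nat, exists Q : R * R,
        [/\ hits a b (P i) (v i) Q,
            P i.+1 = half_turn Q &
            v i.+1 = half_turn (reflect_at a b Q (v i))]].

(* The line {P + t v} is the tangent to the conic x^2/(a-l) + y^2/(b-l) = 1 at
   its point (X : Y : Z).  Homogeneous coordinates are used because a segment
   through the center lies on an asymptote of its hyperbolic caustic, that is,
   on a tangent at a point at infinity (Z = 0). *)
Definition tangent_to_confocal {R : realType} (a b l : R) (P v : R * R)
    : Prop :=
  exists X Y Z : R,
    [/\ (X, Y, Z) <> (0, 0, 0),
        X ^+ 2 / (a - l) + Y ^+ 2 / (b - l) = Z ^+ 2,
        P.1 * X / (a - l) + P.2 * Y / (b - l) = Z &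
        v.1 * X / (a - l) + v.2 * Y / (b - l) = 0].

Definition has_caustic {R : realType} (a b beta : R) (P v : nat -> R * R)
    : Prop :=
  forall i : nat, tangent_to_confocal a b beta (P i) (v i).

(* On the segment that follows the n-th hit, the particle passes through the
   initial position with the initial velocity; t = 0 if the trajectory starts
   on the boundary. *)
Definition n_periodic {R : realType} (n : nat) (P v : nat -> R * R) : Prop :=
  v n = v 0 /\ exists t : R, 0 <= t /\ P 0 = P n + t *: v n.

Definition taylor_coef {R : realType} (f : R -> R) (k : nat) : R :=
  derive1n k f 0 / k`!%:R.

Definition cayley_coef {R : realType} (a b beta : R) (k : nat) : R :=
  taylor_coef (fun x : R => Num.sqrt ((a - x) * (b - x) * (beta - x))) k.

(* The m x m Hankel determinant with upper left entry u s. *)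
Definition hankel_det {R : realType} (u : nat -> R) (s m : nat) : R :=
  \det (\matrix_(i < m, j < m) u (s + i + j)%N).

(* Main.v *)
Require Import Defs.
From HB Require Import structures.
From mathcomp Require Import all_boot all_order all_algebra.
From mathcomp Require Import all_classical all_reals all_analysis.
From mathcomp Require Import ring lra zify.

(* A directed line tangent to the caustic is a point (v1, v2, d), with
   d = v2 x - v1 y, of the curve v1^2 + v2^2 = 1, d^2 = a v2^2 + b v1^2 - beta,
   and this curve is isomorphic over the reals to the cubic
   y^2 = (a - x)(b - x)(beta - x).  If the origin is put on the real component
   that the trajectory avoids, the magic billiard map becomes the translation by
   a point (0, s): with (x_k, y_k) the image of the k-th line, the points
   (x_k, y_k), (0, s) and (x_{k+1}, - y_{k+1}) lie on a line, of slope m_k, and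
   no degenerate chord occurs.

   The group law is replaced by a Lax pair: let L_k be the matrix of the
   multiplication by y on the ideal of (x_k, - y_k), in the basis
   (x - x_k, y + y_k).  The chord gives a linear matrix A_k with determinant x
   and L_k A_k = A_k L_{k+1}.  If L_n = L_0, the product A_0 ... A_{n-1}
   commutes with L_0, hence equals p + q L_0; its determinant x^n is the norm of
   p + q y, so p + q sqrt((a - x)(b - x)(beta - x)) = O(x^n) for one sign of the
   root, and with the degree bounds this is a vanishing Hankel determinant.  Conversely, from such
   p and q the matrix p + q L_0 is divisible by A_0 ... A_{n-1}, and the degrees
   force the quotient to be a constant matrix conjugating L_n to L_0. *)

Set Implicit Arguments.
Unset Strict Implicit.
Unset Printing Implicit Defensive.

Import Order.TTheory GRing.Theory Num.Theory.
Import numFieldNormedType.Exports.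

Local Open Scope ring_scope.

(** Derives an equation from a known one by naming the multiplier [c]; what remains is a ring
    identity. *)
Lemma eq_lin (T : comNzRingType) (c u v x y : T) :
  u = v -> x - y = c * (u - v) -> x = y.
Proof. by move=> -> /eqP; rewrite subrr mulr0 subr_eq0 => /eqP. Qed.

(** * Two by two matrices *)

Section TwoByTwo.
Variable T : comNzRingType.

Definition mx2 (p q r s : T) : 'M[T]_2 :=
  \matrix_(i, j) if i == 0 then (if j == 0 then p else q)
                 else (if j == 0 then r else s).

Lemma mx2_eta (M : 'M[T]_2) : M = mx2 (M 0 0) (M 0 1) (M 1 0) (M 1 1).
Proof.
apply/matrixP => i j; rewrite mxE.
by case: i => [[|[|//]] Hi] /=; case: j => [[|[|//]] Hj] /=; congr (M _ _); apply: val_inj.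
Qed.

Lemma mx2M p q r s p' q' r' s' :
  mx2 p q r s * mx2 p' q' r' s' =
  mx2 (p * p' + q * r') (p * q' + q * s') (r * p' + s * r') (r * q' + s * s').
Proof.
by apply/matrixP => i j; rewrite !mxE !big_ord_recl big_ord0 !mxE /= addr0;
  case: ifP => _; case: ifP.
Qed.

Lemma mx2D p q r s p' q' r' s' :
  mx2 p q r s + mx2 p' q' r' s' = mx2 (p + p') (q + q') (r + r') (s + s').
Proof. by apply/matrixP => i j; rewrite !mxE; case: ifP => _; case: ifP. Qed.

Lemma mx2Z c p q r s : c *: mx2 p q r s = mx2 (c * p) (c * q) (c * r) (c * s).
Proof. by apply/matrixP => i j; rewrite !mxE; case: ifP => _; case: ifP. Qed.

Lemma mx2_1 : 1 = mx2 1 0 0 1.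
Proof. by rewrite (mx2_eta 1) !mxE. Qed.

Lemma mx2_inj p q r s p' q' r' s' :
  mx2 p q r s = mx2 p' q' r' s' -> [/\ p = p', q = q', r = r' & s = s'].
Proof. by move=> /matrixP E; split; [have := E 0 0|have := E 0 1|have := E 1 0|have := E 1 1]; rewrite !mxE. Qed.

Lemma det_mx2 p q r s : \det (mx2 p q r s) = p * s - q * r.
Proof.
rewrite (expand_det_row _ 0) !big_ord_recl big_ord0 /cofactor !det_mx11 !mxE /=.
by rewrite addr0 /= expr0 expr1 mul1r mulN1r mulrN.
Qed.

End TwoByTwo.

Lemma mulmx_cancel (T : idomainType) k (A B C : 'M[T]_k.+1) :
  \det A != 0 -> A * B = A * C -> B = C.
Proof.
move=> dA /(congr1 (fun M => \adj A * M)); rewrite !mulrA.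
rewrite -[\adj A * A]/(\adj A *m A) mul_adj_mx -!mulmxE !mul_scalar_mx => E.
apply/matrixP => i j; apply: (mulfI dA).
by have /matrixP/(_ i j) := E; rewrite !mxE.
Qed.

(** * The Lax pair of a sequence of chords *)

Section Curve.
Variables (R : realFieldType) (e1 e2 s : R).

Definition cubic : {poly R} :=
  - 'X^3 + e1%:P * 'X^2 - e2%:P * 'X + (s ^+ 2)%:P.

Definition cofac (x : R) : {poly R} :=
  - ('X^2 + x%:P * 'X + (x ^+ 2)%:P) + e1%:P * ('X + x%:P) - e2%:P.

Lemma cubic_horner x :
  cubic.[x] = - x ^+ 3 + e1 * x ^+ 2 - e2 * x + s ^+ 2.
Proof. rewrite /cubic !(hornerE, hornerXn). ring. Qed.

Lemma cofacE x : cubic = ('X - x%:P) * cofac x + (cubic.[x])%:P.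
Proof. rewrite cubic_horner /cubic /cofac. ring. Qed.

Lemma deriv_cubic x : cubic^`().[x] = (cofac x).[x].
Proof.
rewrite {1}(cofacE x) derivD derivM derivXsubC derivC mul1r addr0.
by rewrite hornerD hornerM hornerXsubC subrr mul0r addr0.
Qed.

(* Multiplication by the ordinate on the ideal of the point (x, - y) of the
   cubic, in the basis (X - x, Y + y). *)
Definition lax (x y : R) : 'M[{poly R}]_2 :=
  mx2 (- y%:P) ('X - x%:P) (cofac x) y%:P.

Lemma lax_sqr x y : y ^+ 2 = cubic.[x] -> lax x y * lax x y = cubic *: 1.
Proof.
move=> E; rewrite mx2_1 mx2Z mx2M.
have C : cubic = ('X - x%:P) * cofac x + (y ^+ 2)%:P by rewrite E -cofacE.
by congr mx2; rewrite C; ring.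
Qed.

(* Multiplication by (Y - s - m X) / (X - x), from the ideal of (x, - y) to that
   of (x', - y'), where the line of slope m through (0, s) meets the cubic again
   at (x, y) and (x', - y'); it depends on m only. *)
Definition step (m : R) : 'M[{poly R}]_2 :=
  mx2 (- m%:P) 1 ((m ^+ 2)%:P - 'X) (- m%:P).

Lemma det_step m : \det (step m) = 'X.
Proof. rewrite det_mx2; ring. Qed.

(** The hypotheses are Vieta's formulas for the chord: [cubic] minus the square of s + m X is - X
    times the monic quadratic with roots [x] and [x']. *)
Lemma lax_step m x x' :
  x + x' = e1 - m ^+ 2 -> x * x' = e2 + 2 * s * m ->
  lax x (s + m * x) * step m = step m * lax x' (- (s + m * x')).
Proof.
move=> h1 h2.
have E1 : e1 = x + x' + m ^+ 2 by rewrite h1; ring.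
have E2 : e2 = x * x' - 2 * s * m by rewrite h2; ring.
rewrite /lax /step !mx2M /cofac E1 E2; congr mx2; ring.
Qed.

Lemma cubic_chord m x x' :
  x + x' = e1 - m ^+ 2 -> x * x' = e2 + 2 * s * m ->
  cubic.[x] = (s + m * x) ^+ 2.
Proof.
move=> h1 h2.
have E1 : e1 = x + x' + m ^+ 2 by rewrite h1; ring.
have E2 : e2 = x * x' - 2 * s * m by rewrite h2; ring.
rewrite cubic_horner E1 E2; ring.
Qed.

(** In the first row the coefficients of X give [w = 0] and [z = u], so the intertwining matrix is a
    nonzero scalar. *)
Lemma lax_lower_triangular x y x' y' (u w z : R) :
    lax x' y' * mx2 u%:P 0 w%:P z%:P = mx2 u%:P 0 w%:P z%:P * lax x y ->
    mx2 u%:P 0 w%:P z%:P != 0 ->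
  x' = x /\ y' = y.
Proof.
rewrite /lax !mx2M => /mx2_inj[E0 E1 _ _] nz.
have [a0 a1] := (congr1 (horner^~ 0) E0, congr1 (horner^~ 1) E0).
have [b0 b1] := (congr1 (horner^~ 0) E1, congr1 (horner^~ 1) E1).
rewrite !(hornerD, hornerN, hornerM, hornerC, hornerX, horner0) in a0 a1 b0 b1.
have zu : z = u by lra.
have w0 : w = 0 by lra.
have u0 : u != 0.
  apply: contraNneq nz => uz; rewrite zu w0 uz; apply/eqP/matrixP => i j.
  by rewrite !mxE polyC0 !if_same.
by rewrite zu w0 in a0 b0; split; apply: (mulfI u0); lra.
Qed.

Hypothesis cubic_simple : forall z, root cubic z -> ~~ root cubic^`() z.

(** The factor [q] has to be [M 0 1] divided by X - x, so the point is that [M 0 1] vanishes at [x].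
    For [y != 0] this is the (0,1) entry of the commutation; for [y = 0] the number [x] is a root of
    the cubic, and its simplicity keeps [cofac x] from vanishing there. *)
Lemma lax_comm x y (M : 'M[{poly R}]_2) :
    y ^+ 2 = cubic.[x] -> lax x y * M = M * lax x y ->
  exists p q : {poly R}, M = p *: 1 + q *: lax x y.
Proof.
move=> yx; rewrite {1 2}[M]mx2_eta /lax !mx2M => /mx2_inj[E1 E2 _ _].
have t0 : root (M 0 1) x.
  have [y0|y0] := eqVneq y 0.
    have c0 : root cubic x by rewrite /root -yx y0 expr0n.
    have : (M 0 1 * cofac x).[x] = 0.
      rewrite (_ : _ * _ = ('X - x%:P) * M 1 0); last by apply: (eq_lin (c := -1) E1); ring.
      by rewrite hornerM !hornerE subrr mul0r.
    rewrite hornerM => /eqP; rewrite mulf_eq0 => /orP[//|].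
    by have := cubic_simple c0; rewrite /root deriv_cubic => /negbTE ->.
  have : ((2 * y)%:P * M 0 1).[x] = 0.
    rewrite (_ : _ * _ = ('X - x%:P) * (M 1 1 - M 0 0)); last by apply: (eq_lin (c := -1) E2); ring.
    by rewrite hornerM !hornerE subrr mul0r.
  rewrite hornerM hornerC => /eqP.
  by rewrite !mulf_eq0 pnatr_eq0 (negbTE y0).
have /factor_theorem[q Eq] := t0.
exists (M 0 0 + q * y%:P), q.
have Xx : 'X - x%:P != 0 :> {poly R} by rewrite polyXsubC_eq0.
rewrite {1}[M]mx2_eta mx2_1 !mx2Z mx2D Eq; congr mx2; try ring.
  by apply: (mulfI Xx); rewrite Eq in E1; apply: (eq_lin (c := 1) E1); ring.
by apply: (mulfI Xx); rewrite Eq in E2; apply: (eq_lin (c := 1) E2); ring.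
Qed.

Variables (x y m : nat -> R).
Hypothesis s_neq0 : s != 0.
Hypothesis yE : forall k, y k = s + m k * x k.
Hypothesis yS : forall k, y k.+1 = - (s + m k * x k.+1).
Hypothesis x_add : forall k, x k + x k.+1 = e1 - m k ^+ 2.
Hypothesis x_mul : forall k, x k * x k.+1 = e2 + 2 * s * m k.

Let L k := lax (x k) (y k).
Let A k := step (m k).

Fixpoint step_prod (k : nat) : 'M[{poly R}]_2 :=
  if k is k'.+1 then step_prod k' * A k' else 1.

Lemma y_sqr k : y k ^+ 2 = cubic.[x k].
Proof. by rewrite (cubic_chord (x_add k) (x_mul k)) yE. Qed.

Lemma lax_stepE k : L k * A k = A k * L k.+1.
Proof. by rewrite /L /A yE yS; apply: lax_step. Qed.

Lemma step_prod_lax k : L 0 * step_prod k = step_prod k * L k.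
Proof.
elim: k => [|k IH] /=; first by rewrite mulr1 mul1r.
by rewrite mulrA IH -!mulrA lax_stepE.
Qed.

Lemma det_step_prod k : \det (step_prod k) = 'X^k.
Proof.
elim: k => [|k IH] /=; first by rewrite det1.
by rewrite det_mulmx IH det_step exprSr.
Qed.

Lemma absc_neq0 k : x k.+1 != 0.
Proof.
apply/eqP => h; have := yE k.+1; rewrite yS h !mulr0 !addr0 => /eqP.
by rewrite eqNr (negbTE s_neq0).
Qed.

Lemma slope_add_neq0 k : m k + m k.+1 != 0.
Proof.
apply/eqP => h; have h2 := yE k.+1; rewrite yS in h2.
have : s * 2 = - ((m k + m k.+1) * x k.+1) by lra.
by rewrite h mul0r oppr0 => /eqP; rewrite mulf_eq0 (negbTE s_neq0) pnatr_eq0.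
Qed.

(** At X = 0 a step has rank one: it is the column (1, - m) times the row (- m, 1). Consecutive
    factors contract to - (m_k + m_{k+1}), which is nonzero. *)
Lemma step_prod_at0 k :
  (step_prod k.+1 0 1).[0] != 0 /\
  (step_prod k.+1 0 0).[0] = - m k * (step_prod k.+1 0 1).[0].
Proof.
elim: k => [|k [IH1 IH2]].
  rewrite /= mul1r /A !mxE /= !hornerE; split; [exact: oner_neq0|ring].
have -> : step_prod k.+2 = step_prod k.+1 * A k.+1 by [].
set M := step_prod k.+1 in IH1 IH2 *; rewrite [M]mx2_eta.
rewrite mx2M ![mx2 _ _ _ _ _ _]mxE /=.
rewrite -polyC1 !(hornerD, hornerM, hornerN, hornerX, hornerC) IH2.
split; last by ring.
rewrite (_ : _ + _ = - ((m k + m k.+1) * (M 0 1).[0])); last by ring.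
by rewrite oppr_eq0 mulf_eq0 negb_or slope_add_neq0.
Qed.

(* The bound is shifted by 2: X^j satisfies wt k iff 2 j + 2 <= k. *)
Definition wt (k : nat) (p : {poly R}) : bool := ((size p).*2 <= k)%N.

Lemma wtM (i j k : nat) (p q : {poly R}) :
  wt i p -> wt j q -> (i + j <= k + 2)%N -> wt k (p * q).
Proof.
rewrite /wt => hp hq hk.
have [->|p0] := eqVneq p 0; first by rewrite mul0r size_poly0.
have [->|q0] := eqVneq q 0; first by rewrite mulr0 size_poly0.
have := size_polyMleq p q; rewrite -size_poly_gt0 in p0.
rewrite -size_poly_gt0 in q0; lia.
Qed.

Lemma wtD (k : nat) (p q : {poly R}) : wt k p -> wt k q -> wt k (p + q).
Proof. by rewrite /wt => hp hq; have := size_polyD p q; lia. Qed.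

Lemma wtN (k : nat) (p : {poly R}) : wt k p -> wt k (- p).
Proof. by rewrite /wt size_polyN. Qed.

Lemma wtC (c : R) k : wt k.+2 c%:P.
Proof. by rewrite /wt; have := size_polyC_leq1 c; lia. Qed.

Lemma wtX k : wt k.+4 'X.
Proof. by rewrite /wt size_polyX. Qed.

Lemma wt1_eq0 (u : {poly R}) : wt 1 u -> u = 0.
Proof. by move=> h; apply/eqP; rewrite -size_poly_eq0; move: h; rewrite /wt; lia. Qed.

Lemma wt3_polyC (u : {poly R}) : wt 3 u -> u = (u`_0)%:P.
Proof. by rewrite /wt => h; apply: size1_polyC; lia. Qed.

Lemma wt_le23 (u : {poly R}) : wt 2 u -> wt 3 u.
Proof. by rewrite /wt; lia. Qed.

Lemma wtM_shift (i j l k : nat) (u v : {poly R}) :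
  wt (i + k) u -> wt (j + k) v -> (i + j <= l + 4)%N ->
  wt (l + k.*2.+2) (u * v).
Proof. by move=> hu hv hl; apply: wtM hu hv _; lia. Qed.

Lemma wt_divXn i k (u : {poly R}) : wt (i + k.*2.+2) (u * 'X^(k.+1)) -> wt i u.
Proof.
rewrite /wt; have [->|u0] := eqVneq u 0; first by rewrite size_poly0.
rewrite size_Mmonic ?monicXn // size_polyXn; lia.
Qed.

Lemma wt_cofac (c : R) : wt 6 (cofac c).
Proof.
have cX (d : R) : wt 6 (d%:P * 'X) by apply: (@wtM 2 4) => //; [exact: wtC|exact: wtX].
rewrite /cofac mulrDr -polyCM.
apply: wtD; last exact/wtN/wtC.
apply: wtD; last by apply: wtD; [exact: cX|exact: wtC].
apply: wtN; apply: wtD; last exact: wtC.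
by apply: wtD; [rewrite /wt size_polyXn|exact: cX].
Qed.

(* With weight 2 for X, the entries (0,1), (i,i), (1,0) have weights at most
   k - 1, k, k + 1. *)
Lemma wt_step_prod k :
  [/\ wt k.+2 (step_prod k 0 0), wt k.+1 (step_prod k 0 1),
      wt k.+3 (step_prod k 1 0) & wt k.+2 (step_prod k 1 1)].
Proof.
elim: k => [|k [h1 h2 h3 h4]] /=.
  by rewrite mx2_1 !mxE /= -polyC0 -polyC1; split; rewrite ?wtC // /wt size_poly0.
rewrite [step_prod k]mx2_eta mx2M ![mx2 _ _ _ _ _ _]mxE /=.
have wX : wt 4 ((m k ^+ 2)%:P - 'X) by apply: wtD; [exact: wtC|exact/wtN/wtX].
have wm : wt 2 (- (m k)%:P) by apply/wtN/wtC.
have w1 : wt 2 1 by rewrite -polyC1 wtC.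
split; apply: wtD.
- by apply: wtM h1 wm _; lia.
- by apply: wtM h2 wX _; lia.
- by apply: wtM h1 w1 _; lia.
- by apply: wtM h2 wm _; lia.
- by apply: wtM h3 wm _; lia.
- by apply: wtM h4 wX _; lia.
- by apply: wtM h3 w1 _; lia.
- by apply: wtM h4 wm _; lia.
Qed.

Lemma pade_of_closing n (S : {poly R}) :
    x n.+1 = x 0%N -> y n.+1 = y 0%N -> 'X^(n.+1) %| S ^+ 2 - cubic ->
  exists p q : {poly R}, [/\ q != 0, wt n q, wt n.+3 p & 'X^(n.+1) %| p + q * S].
Proof.
move=> xn yn hS.
have comm : L 0 * step_prod n.+1 = step_prod n.+1 * L 0.
  by rewrite step_prod_lax /L xn yn.
have [p [q EM]] := lax_comm (y_sqr 0) comm.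
have [nz _] := step_prod_at0 n.
have [w00 w01 _ _] := wt_step_prod n.+1.
have := det_step_prod n.+1.
rewrite EM /L /lax mx2_1 !mx2Z mx2D in nz w00 w01 *; rewrite !mxE /= in nz w00 w01 *.
rewrite det_mx2 => Edet.
have cE : cubic = ('X - (x 0)%:P) * cofac (x 0) + ((y 0) ^+ 2)%:P.
  by rewrite y_sqr -cofacE.
have {}Edet : p ^+ 2 - q ^+ 2 * cubic = 'X^(n.+1).
  by rewrite -Edet cE; ring.
rewrite mulr0 add0r in nz w01.
have q0 : q != 0 by apply: contraNneq nz => ->; rewrite mul0r horner0.
have wq : wt n q.
  move: w01; rewrite /wt size_Mmonic ?monicXsubC // size_XsubC; lia.
have wp : wt n.+3 p.
  rewrite (_ : p = (p * 1 + q * - (y 0)%:P) + q * (y 0)%:P); last by ring.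
  apply: wtD => //; apply: (@wtM n 2) => //; [exact: wtC|lia].
have qh : q.[0] != 0 by apply: contraNneq nz => qz; rewrite hornerM qz mul0r.
have ph : p.[0] != 0.
  apply: contraNneq qh => pz; have /= := congr1 (horner^~ 0) Edet.
  rewrite hornerD hornerN !horner_exp hornerM horner_exp cubic_horner hornerX pz.
  rewrite !expr0n /= => h; have /eqP : (q.[0] * s) ^+ 2 = 0 by lra.
  by rewrite expf_eq0 /= mulf_eq0 (negbTE s_neq0) orbF.
have dv : 'X^(n.+1) %| (p + q * S) * (p - q * S).
  rewrite (_ : _ * _ = 'X^(n.+1) - q ^+ 2 * (S ^+ 2 - cubic)).
    by rewrite dvdp_sub // dvdp_mull.
  by rewrite -Edet; ring.
have cop (g : {poly R}) : g.[0] != 0 -> coprimep 'X^(n.+1) g.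
  by move=> g0; rewrite coprimep_sym coprimep_expr // coprimepX.
(* Since [p] does not vanish at 0, neither do both factors; the one that does not is coprime to X,
   so the other one takes the whole power. *)
have [h|h] := eqVneq (p - q * S).[0] 0.
  exists p, (- q); split; rewrite ?oppr_eq0 ?wtN //.
  rewrite mulNr; move: h; rewrite !(hornerD, hornerN) => h.
  have g0 : (p + q * S).[0] != 0.
    rewrite hornerD (_ : _ + _ = 2 * p.[0]); last by lra.
    by rewrite mulf_neq0 ?pnatr_eq0.
  by move: dv; rewrite (Gauss_dvdpr _ (cop _ g0)).
exists p, q; split=> //; by move: dv; rewrite (Gauss_dvdpl _ (cop _ h)).
Qed.

(** * From an approximant back to a closed orbit *)

Section Approximant.
Variable S : {poly R}.
Hypothesis S0 : S.[0] = s.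

(* At X = 0 the hypothesis says that the columns of U are orthogonal to (m, 1),
   which is also the direction of the rows of the adjugate of A k. *)
Lemma step_divides k j (U E : 'M[{poly R}]_2) :
    (L k + S *: 1) * U = 'X^(j.+1) *: E ->
  exists U' E' : 'M[{poly R}]_2,
    U = A k * U' /\ (L k.+1 + S *: 1) * U' = 'X^j *: E'.
Proof.
move=> hU.
have z i i' : (((L k + S *: 1) * U) i i').[0] = 0.
  by rewrite hU mxE hornerM hornerXn expr0n mul0r.
have yk := yE k; have yk2 := y_sqr k; rewrite cubic_horner in yk2.
have gen (u v : {poly R}) :
    ((- (y k)%:P + S) * u + ('X - (x k)%:P) * v).[0] = 0 ->
    (cofac (x k) * u + ((y k)%:P + S) * v).[0] = 0 ->
    exists g, (m k)%:P * u + v = 'X * g.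
  rewrite /cofac !(hornerD, hornerN, hornerM, hornerC, hornerX, horner_exp, S0).
  set u0 := u.[0]; set v0 := v.[0] => h1 h2.
  have r0 : root ((m k)%:P * u + v) 0.
    rewrite /root hornerD hornerM hornerC -/u0 -/v0.
    have h1' : x k * (m k * u0 + v0) = 0.
      by apply: (eq_lin (c := -1) h1); rewrite yk; ring.
    (* By the chord relations [cofac (x k)] takes the value [m k * (s + y k)] at 0. *)
    have h2' : (s + y k) * (m k * u0 + v0) = 0.
      have E1 : e1 = x k + x k.+1 + m k ^+ 2 by rewrite x_add; ring.
      have E2 : e2 = x k * x k.+1 - 2 * s * m k by rewrite x_mul; ring.
      by apply: (eq_lin (c := 1) h2); rewrite yk E1 E2; ring.
    (* The factors [x k] and [s + y k] cannot both vanish: [x k = 0] forces [y k = s]. *)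
    have [xz|xz] := eqVneq (x k) 0.
      have sy : s + y k != 0.
        rewrite (_ : s + y k = 2 * s); last by rewrite yk xz; ring.
        by rewrite mulf_neq0 ?pnatr_eq0.
      by apply/eqP/(mulfI sy); rewrite mulr0.
    by apply/eqP/(mulfI xz); rewrite mulr0.
  have /factor_theorem[g Eg] := r0.
  by exists g; rewrite Eg subr0 mulrC.
rewrite [U]mx2_eta /L /lax mx2_1 mx2Z mx2D mx2M in z.
have z00 := z 0 0; have z01 := z 0 1; have z10 := z 1 0; have z11 := z 1 1.
rewrite !mxE /= ?mulr0 ?mulr1 ?addr0 in z00 z01 z10 z11.
have [g Eg] := gen _ _ z00 z10; have [h Eh] := gen _ _ z01 z11.
(* This is the adjugate of [A k] times [U], divided by X, the determinant of [A k]. *)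
pose U' := mx2 (- g) (- h) (U 0 0 - (m k)%:P * g) (U 0 1 - (m k)%:P * h).
have EU : U = A k * U'.
  rewrite [LHS]mx2_eta /A /step mx2M; congr mx2; try ring.
    by apply: (eq_lin (c := 1) Eg); ring.
  by apply: (eq_lin (c := 1) Eh); ring.
exists U', (\adj (A k) * E); split=> //.
have H : A k * ((L k.+1 + S *: 1) * U') = 'X^(j.+1) *: E.
  rewrite -hU EU !mulrA mulrDr !mulrDl lax_stepE.
  by rewrite -scalerAr mulr1 -[S *: 1 * A k]scalerAl mul1r.
apply: (@mulmx_cancel _ _ (A k)); first by rewrite det_step polyX_eq0.
rewrite H -scalerAr mulrA -[A k * \adj _]/(A k *m \adj _) mul_mx_adj det_step.
by rewrite -mulmxE mul_scalar_mx scalerA exprSr.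
Qed.

(** Each power of X pays for splitting off one factor [A k]. *)
Lemma step_prod_divides n (K E : 'M[{poly R}]_2) :
    (L 0 + S *: 1) * K = 'X^n *: E ->
  exists U : 'M[{poly R}]_2, K = step_prod n * U.
Proof.
move=> hK.
suff [U [E' [? _]]] : exists U E' : 'M[{poly R}]_2,
    K = step_prod n * U /\ (L n + S *: 1) * U = 'X^(n - n) *: E' by exists U.
suff H k : (k <= n)%N -> exists U E' : 'M[{poly R}]_2,
    K = step_prod k * U /\ (L k + S *: 1) * U = 'X^(n - k) *: E' by exact: H.
elim: k => [|k IH] lkn; first by exists K, E; rewrite mul1r subn0.
have [U [E' [-> hU]]] := IH (ltnW lkn).
rewrite -subnSK // in hU.
have [U' [E'' [-> hU']]] := step_divides hU.
by exists U', E''; rewrite mulrA.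
Qed.

Lemma closing_of_pade n (p q : {poly R}) :
    'X^(n.+1) %| S ^+ 2 - cubic -> q != 0 -> wt n q -> wt n.+3 p ->
    'X^(n.+1) %| p + q * S ->
  x n.+1 = x 0%N /\ y n.+1 = y 0%N.
Proof.
move=> /dvdpP[g hg] q0 wq wp /dvdpP[h hh].
pose K := p *: 1 + q *: L 0.
have KL : L 0 * K = K * L 0.
  by rewrite mulrDr mulrDl -!scalerAl -!scalerAr mul1r mulr1.
have [U EK] : exists U, K = step_prod n.+1 * U.
  (* As the square of [L 0] is [cubic], (L + S)(p + q L) = (p + q S)(L + S) - q (S^2 - cubic), and
     both terms are divisible by the required power of X. *)
  apply: (@step_prod_divides _ _ (h *: (L 0 + S *: 1) - (q * g) *: 1)).
  have -> : (L 0 + S *: 1) * K = (p + q * S) *: (L 0 + S *: 1)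
      - (q * (S ^+ 2 - cubic)) *: 1.
    rewrite !mulrDl !mulrDr -!scalerAl -!scalerAr ?mul1r ?mulr1 lax_sqr ?y_sqr //.
    apply/matrixP => i j; rewrite !mxE; ring.
  rewrite hg hh; apply/matrixP => i j; rewrite !mxE; ring.
have UL : L n.+1 * U = U * L 0.
  apply: (@mulmx_cancel _ _ (step_prod n.+1)).
    by rewrite det_step_prod expf_neq0 // polyX_eq0.
  by rewrite mulrA -step_prod_lax -mulrA -EK KL EK mulrA.
have dM := det_step_prod n.+1.
have [m00 m01 m10 m11] := wt_step_prod n.+1.
set M := step_prod n.+1 in EK dM m00 m01 m10 m11.
have wk (c : R) : wt n.+3 (p + q * c%:P).
  by apply: wtD => //; apply: (@wtM n 2) => //; [exact: wtC|lia].
have wXC (c : R) : wt 4 ('X - c%:P) by apply: wtD; [exact: wtX|exact/wtN/wtC].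
have [k00 k01 k10 k11] : [/\ wt n.+3 (K 0 0), wt n.+2 (K 0 1), wt n.+4 (K 1 0)
    & wt n.+3 (K 1 1)].
  rewrite /K /L /lax mx2_1 !mx2Z mx2D !mxE /= !mulr0 !add0r !mulr1 -polyCN.
  split=> //.
    by apply: (@wtM n 4) => //; lia.
  by apply: (@wtM n 6) => //; [exact: wt_cofac|lia].
rewrite [M]mx2_eta det_mx2 in dM.
have [e00 e01 e10 e11] : [/\ K 0 0 = M 0 0 * U 0 0 + M 0 1 * U 1 0,
   K 0 1 = M 0 0 * U 0 1 + M 0 1 * U 1 1, K 1 0 = M 1 0 * U 0 0 + M 1 1 * U 1 0
   & K 1 1 = M 1 0 * U 0 1 + M 1 1 * U 1 1].
  by rewrite EK {1 4 7 10}[M]mx2_eta [U]mx2_eta mx2M !mxE.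
(* Cramer's rule: [U] times X^(n+1) is the adjugate of [M] times [K]. Counting weights leaves
   constants in [U], and 0 in the entry (0,1). *)
have w00 : wt 2 (U 0 0).
  apply: (@wt_divXn _ n); rewrite -dM.
  rewrite (_ : _ * _ = M 1 1 * K 0 0 - M 0 1 * K 1 0); last by rewrite e00 e10; ring.
  by apply: wtD; [exact: (@wtM_shift 3 3 _ _ _ _ m11 k00)|exact/wtN/(@wtM_shift 2 4 _ _ _ _ m01 k10)].
have w01 : wt 1 (U 0 1).
  apply: (@wt_divXn _ n); rewrite -dM.
  rewrite (_ : _ * _ = M 1 1 * K 0 1 - M 0 1 * K 1 1); last by rewrite e01 e11; ring.
  by apply: wtD; [exact: (@wtM_shift 3 2 _ _ _ _ m11 k01)|exact/wtN/(@wtM_shift 2 3 _ _ _ _ m01 k11)].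
have w10 : wt 3 (U 1 0).
  apply: (@wt_divXn _ n); rewrite -dM.
  rewrite (_ : _ * _ = M 0 0 * K 1 0 - M 1 0 * K 0 0); last by rewrite e00 e10; ring.
  by apply: wtD; [exact: (@wtM_shift 3 4 _ _ _ _ m00 k10)|exact/wtN/(@wtM_shift 4 3 _ _ _ _ m10 k00)].
have w11 : wt 2 (U 1 1).
  apply: (@wt_divXn _ n); rewrite -dM.
  rewrite (_ : _ * _ = M 0 0 * K 1 1 - M 1 0 * K 0 1); last by rewrite e01 e11; ring.
  by apply: wtD; [exact: (@wtM_shift 3 3 _ _ _ _ m00 k11)|exact/wtN/(@wtM_shift 4 2 _ _ _ _ m10 k01)].
have u01 : U 0 1 = 0 by exact: wt1_eq0.
have EU : U = mx2 ((U 0 0)`_0)%:P 0 ((U 1 0)`_0)%:P ((U 1 1)`_0)%:P.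
  by rewrite {1}[U]mx2_eta u01; congr mx2; apply: wt3_polyC; rewrite // wt_le23.
move: (U 0 0)`_0 (U 1 0)`_0 (U 1 1)`_0 EU => u w z EU; rewrite EU in UL.
have U0 : U != 0.
  apply: contraNneq q0 => U0; have : K 0 1 = 0 by rewrite EK U0 mulr0 mxE.
  rewrite /K /L /lax mx2_1 !mx2Z mx2D mxE /= mulr0 add0r => /eqP.
  by rewrite mulf_eq0 polyXsubC_eq0 orbF.
by rewrite EU in U0; exact: lax_lower_triangular UL U0.
Qed.

End Approximant.

End Curve.

(** * Hankel determinants and approximants *)

Section Hankel.
Variables (R : realFieldType) (B : nat -> R) (n : nat).
Let h := n./2.
Let S : {poly R} := \poly_(i < n.+1) B i.

Lemma dvdXnP k (p : {poly R}) :
  reflect (forall i, (i < k)%N -> p`_i = 0) ('X^k %| p).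
Proof.
apply: (iffP idP) => [/dvdpP[q ->] i ik|E]; first by rewrite coefMXn ik.
rewrite -(poly_take_drop k p) (_ : take_poly k p = 0) ?add0r ?dvdp_mulIr //.
by apply/polyP => i; rewrite coef_take_poly coef0; case: ifP => // /E.
Qed.

(** A convolution becomes a Hankel product once the coefficients of [q] are listed in reverse order;
    [n.+1 - h] is the first degree that [p] cannot reach. *)
Lemma coef_mul_hankel (q : {poly R}) (j : 'I_h) : wt n q ->
  (q * S)`_(n.+1 - h + j) = \sum_(i < h) q`_(rev_ord i) * B (odd n + 2 + i + j).
Proof.
rewrite /wt => hq; have jh := ltn_ord j.
rewrite coefM.
pose F l := q`_l * S`_(n.+1 - h + j - l).
rewrite -(big_mkord xpredT F).
have sq : (size q <= h)%N by rewrite /h; lia.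
have hc : (h <= (n.+1 - h + j).+1)%N by rewrite /h; lia.
rewrite (big_cat_nat (leq0n h) hc) /= [X in _ + X]big1_seq ?addr0; last first.
  move=> l /=; rewrite mem_index_iota => /andP[hl _].
  by rewrite /F nth_default ?mul0r // (leq_trans sq hl).
rewrite big_mkord (reindex_inj rev_ord_inj) /=; apply: eq_bigr => i _.
have ih := ltn_ord i; rewrite /F coef_poly.
rewrite /h in jh ih *.
rewrite ifT; last by lia.
by congr (_ * B _); lia.
Qed.

(** [p] cancels the lowest [n.+1 - h] coefficients of [q * S] freely. The other [h] conditions form
    a homogeneous system for the [h] coefficients of [q], with the Hankel matrix. *)
Lemma hankel_pade :
  \det (\matrix_(i < h, j < h) B (odd n + 2 + i + j)%N) = 0 <->
  exists p q : {poly R},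
    [/\ q != 0, wt n q, wt n.+3 p & 'X^(n.+1) %| p + q * S].
Proof.
split=> [/eqP/det0P[v v0 vH]|[p [q [q0 wq wp /dvdXnP dv]]]].
  pose q : {poly R} := rVpoly (\row_i v 0 (rev_ord i)).
  have qE (k : 'I_h) : q`_(rev_ord k) = v 0 k.
    by rewrite [LHS]coef_rVpoly_ord mxE rev_ordK.
  have sq : (size q <= h)%N by exact: size_poly.
  have wq : wt n q by rewrite /wt; rewrite /h in sq; lia.
  exists (- take_poly (n.+1 - h) (q * S)), q; split=> //.
  - apply: contraNneq v0 => qz; apply/eqP/rowP => i.
    by rewrite -qE qz coef0 mxE.
  - rewrite /wt size_polyN.
    apply: (@leq_trans (n.+1 - h).*2); last by rewrite /h; lia.
    by rewrite leq_double size_take_poly.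
  apply/dvdXnP => i ik; rewrite coefD coefN coef_take_poly.
  case: ltnP => [_|hi]; first by rewrite addNr.
  have hj : (i - (n.+1 - h) < h)%N by rewrite /h in hi *; lia.
  have := coef_mul_hankel (Ordinal hj) wq; rewrite /= subnKC // => ->.
  rewrite oppr0 add0r; have /rowP/(_ (Ordinal hj)) := vH.
  rewrite !mxE => E; rewrite -[RHS]E; apply: eq_bigr => k _.
  by rewrite mxE qE.
have sq : (size q <= h)%N by rewrite /h -(doubleK (size q)) half_leq.
have sp : (size p <= n.+1 - h)%N.
  apply: (@leq_trans n.+3./2); last by rewrite /h; lia.
  by rewrite -(doubleK (size p)) half_leq.
apply/eqP/det0P; exists (\row_i q`_(rev_ord i)).
  apply: contraNneq q0 => /rowP vz; apply/eqP/polyP => i; rewrite coef0.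
  have [hi|hi] := ltnP i h; last first.
    by rewrite nth_default // (leq_trans sq hi).
  by have := vz (rev_ord (Ordinal hi)); rewrite !mxE rev_ordK.
apply/rowP => j; rewrite !mxE.
have jh := ltn_ord j.
have dj : (p + q * S)`_(n.+1 - h + j) = 0 by apply: dv; rewrite /h in jh *; lia.
rewrite coefD [p`__]nth_default ?add0r ?coef_mul_hankel // in dj; last first.
  by rewrite (leq_trans sp) // leq_addr.
by rewrite -[RHS]dj; apply: eq_bigr => i _; rewrite !mxE.
Qed.

End Hankel.

Lemma closing_iff_hankel (R : realFieldType) (e1 e2 s : R) (x y m B : nat -> R)
    (n : nat) :
    (forall z, root (cubic e1 e2 s) z -> ~~ root (cubic e1 e2 s)^`() z) ->
    s != 0 ->
    (forall k, y k = s + m k * x k) ->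
    (forall k, y k.+1 = - (s + m k * x k.+1)) ->
    (forall k, x k + x k.+1 = e1 - m k ^+ 2) ->
    (forall k, x k * x k.+1 = e2 + 2 * s * m k) ->
    'X^(n.+1) %| (\poly_(i < n.+1) B i) ^+ 2 - cubic e1 e2 s ->
  x n.+1 = x 0%N /\ y n.+1 = y 0%N <->
  \det (\matrix_(i < n./2, j < n./2) B (odd n + 2 + i + j)%N) = 0.
Proof.
move=> simple s0 yE yS xadd xmul; set S := \poly_(i < n.+1) B i => dS.
apply: iff_trans (iff_sym (hankel_pade B n)); rewrite -/S.
split=> [[xn yn]|[p [q [q0 wq wp dv]]]].
  exact: (pade_of_closing simple s0 yE yS xadd xmul).
have /eqP : S.[0] ^+ 2 = s ^+ 2.
  have /dvdpP[g /(congr1 (horner^~ 0))] := dS.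
  rewrite hornerD hornerN cubic_horner horner_exp hornerM hornerXn !expr0n /=.
  by move=> h; lra.
(* The square determines the series only up to sign; for the wrong sign, [S] and [q] are both
   negated. *)
rewrite eqf_sqr => /orP[/eqP S0|/eqP S0].
  exact: (closing_of_pade s0 yE yS xadd xmul S0 dS q0 wq wp dv).
apply: (@closing_of_pade _ _ _ _ _ _ _ s0 yE yS xadd xmul (- S) _ n p (- q)).
- by rewrite hornerN S0 opprK.
- by rewrite sqrrN.
- by rewrite oppr_eq0.
- exact: wtN.
- by [].
- by rewrite mulrNN.
Qed.

(** * Taylor coefficients of the square root of a polynomial *)

Section SqrtSeries.
Variables (R : realType) (F : {poly R}).

(* The k-th derivative of sqrt F is k! Q_k sqrt F / F^k. *)
Fixpoint sqrt_num (k : nat) : {poly R} :=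
  if k is j.+1 then
    (j.+1%:R)^-1 *: ((sqrt_num j)^`() * F + (2^-1 - j%:R) *: (sqrt_num j * F^`()))
  else 1.

Lemma sqrt_numS k : (k.+1%:R)%:P * sqrt_num k.+1 =
  (sqrt_num k)^`() * F + (2^-1 - k%:R)%:P * (sqrt_num k * F^`()).
Proof.
by rewrite /= mul_polyC scalerA divff ?pnatr_eq0 // scale1r mul_polyC.
Qed.

Lemma derive1n_sqrt k x : 0 < F.[x] ->
  derive1n k (fun z => Num.sqrt F.[z]) x =
  k`!%:R * (sqrt_num k).[x] * Num.sqrt F.[x] / F.[x] ^+ k.
Proof.
elim: k x => [|k IH] x Fx.
  by rewrite derive1n0 /= hornerE expr0 divr1 -polyC1 hornerC mul1r.
rewrite derive1nS derive1E.
pose r := Num.sqrt \o horner F.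
pose G := (horner (k`!%:R *: sqrt_num k) * r) * (fun z => (F.[z] ^+ k)^-1).
(* The induction hypothesis requires [F] to be positive, which holds in a neighbourhood of [x]. *)
rewrite (@near_eq_derive _ _ _ _ G); last first.
  have : \forall z \near x, 0 < F.[z] by exact: (cvgr_gt _ (@continuous_horner _ F x)).
  by apply: filterS => z Fz; rewrite IH // /G /r !fctE /= hornerZ.
have dF := is_derive_poly F x.
have dr : is_derive x (1 : R) r ((2 * Num.sqrt F.[x])^-1 * F^`().[x]).
  by apply: is_derive1_comp dF; exact: is_derive1_sqrt.
have Fk0 : F.[x] ^+ k != 0 by rewrite expf_neq0 // gt_eqF.
have dV : is_derive x (1 : R) (fun z => (F.[z] ^+ k)^-1)
    (- (F.[x] ^+ k) ^- 2 *: (k%:R * F.[x] ^+ k.-1 *: F^`().[x])).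
  by apply: is_deriveV => //; have := is_deriveX k dF; rewrite exprfctE.
have dG := is_deriveM (is_deriveM (is_derive_poly (k`!%:R *: sqrt_num k) x) dr) dV.
rewrite (derive_val (is_derive := dG)) /r /=.
have Fx0 : F.[x] != 0 by rewrite gt_eqF.
have s2 : Num.sqrt F.[x] ^+ 2 = F.[x] by rewrite sqr_sqrtr // ltW.
have s0 : Num.sqrt F.[x] != 0 by rewrite gt_eqF // sqrtr_gt0.
have kX : k%:R * F.[x] ^+ k.-1 = k%:R * F.[x] ^+ k / F.[x].
  by case: (k) => [|j]; rewrite ?mul0r // exprSr /= mulrA mulfK.
rewrite !fctE /= kX derivZ !(hornerZ, hornerD, hornerM) factS natrM [F.[x] ^+ k.+1]exprSr.
rewrite /GRing.scale /=; move: s0 Fk0 s2 Fx0.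
move: (F.[x]) (k`!%:R) (Num.sqrt F.[x]) (F.[x] ^+ k) => y K u Y u0 Y0 uy y0.
have k1 : k.+1%:R != 0 :> R by rewrite pnatr_eq0.
move: k1; rewrite -natr1 => k1.
by rewrite -uy; field; rewrite k1 u0 Y0.
Qed.

Definition sqrt_conv (n : nat) : {poly R} :=
  \sum_(i < n.+1) sqrt_num i * sqrt_num (n - i).

(** The recursion of [sqrt_num] with the exponent 1/2 replaced by 1, as befits the product of two
    square roots. *)
Lemma sqrt_convS n : n.+1%:R%:P * sqrt_conv n.+1 =
  (sqrt_conv n)^`() * F + (1 - n%:R)%:P * (sqrt_conv n * F^`()).
Proof.
pose A j := j%:R%:P * sqrt_num j.
have A0 : A 0%N = 0 by rewrite /A polyC0 mul0r.
have -> : n.+1%:R%:P * sqrt_conv n.+1 =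
    \sum_(j < n.+2) A j * sqrt_num (n.+1 - j) +
    \sum_(j < n.+2) sqrt_num j * A (n.+1 - j)%N.
  rewrite -big_split mulr_sumr; apply: eq_bigr => j _ /=.
  have jn : (j <= n.+1)%N by rewrite -ltnS.
  by rewrite /A -{1}(subnKC jn) natrD polyCD; ring.
rewrite big_ord_recl A0 mul0r add0r [X in _ + X]big_ord_recr /= subnn A0 mulr0 addr0.
rewrite -big_split /sqrt_conv raddf_sum !mulr_suml mulr_sumr -big_split.
apply: eq_bigr => i _ /=; have ni : (i <= n)%N by rewrite -ltnS.
have nE : n%:R = i%:R + (n - i)%:R :> R by rewrite -natrD subnKC.
rewrite subSS subSn // /A !sqrt_numS derivM nE !polyCB polyCD.
rewrite (_ : 1%:P = 2^-1%:P + 2^-1%:P); last first.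
  by rewrite -polyCD; congr _%:P; field.
ring.
Qed.

(** The Leibniz rule for F as the square of its root, stated and proved among polynomials. *)
Lemma sqrt_conv_derivn n :
  n`!%:R%:P * sqrt_conv n * F = F ^+ n * F^`(n).
Proof.
elim: n => [|n IH].
  by rewrite /sqrt_conv big_ord1 /= !mulr1 expr0.
have Fn : n`!%:R%:P * (sqrt_conv n)^`() * F + n`!%:R%:P * sqrt_conv n * F^`() =
    n%:R%:P * F ^+ n.-1 * F^`() * F^`(n) + F ^+ n * F^`(n.+1).
  have := congr1 (@deriv R) IH.
  rewrite !derivM derivC mul0r add0r deriv_exp -derivnS => ->; congr (_ + _).
  by rewrite polyC_natr -mulr_natl; ring.
have nF : n%:R%:P * F ^+ n.-1 * F = n%:R%:P * F ^+ n.
  by case: (n) => [|j]; rewrite ?mul0r // exprSr mulrA.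
rewrite factS natrM polyCM -mulrA mulrCA -mulrA mulrCA.
rewrite [n.+1%:R%:P * _]mulrA sqrt_convS polyCB.
transitivity (F * (n`!%:R%:P * (sqrt_conv n)^`() * F
  + n`!%:R%:P * sqrt_conv n * F^`()) - n%:R%:P * F^`() * (n`!%:R%:P * sqrt_conv n * F)).
  ring.
rewrite Fn IH exprSr mulrDr.
rewrite (_ : F * (_ * _ * _ * _) = (n%:R%:P * F ^+ n.-1 * F) * F^`() * F^`(n)); last by ring.
by rewrite nF; ring.
Qed.

Lemma taylor_sqrt_sqr N : 0 < F.[0] ->
  'X^N %| (\poly_(i < N) taylor_coef (fun z => Num.sqrt F.[z]) i) ^+ 2 - F.
Proof.
move=> F0; apply/dvdXnP => k kN.
have F00 : F.[0] != 0 by rewrite gt_eqF.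
have fact0 i : i`!%:R != 0 :> R by rewrite pnatr_eq0 -lt0n fact_gt0.
have tE i : taylor_coef (fun z => Num.sqrt F.[z]) i
    = (sqrt_num i).[0] * Num.sqrt F.[0] / F.[0] ^+ i.
  by rewrite /taylor_coef derive1n_sqrt //; field; rewrite fact0 expf_neq0.
rewrite coefB expr2 coefM; apply/eqP; rewrite subr_eq0; apply/eqP.
have -> : F`_k = (F^`(k)).[0] / k`!%:R.
  by rewrite horner_coef0 coef_derivn addn0 ffactnn -[F`_k *+ _]mulr_natr mulfK.
have E := congr1 (horner^~ 0) (sqrt_conv_derivn k).
rewrite !hornerM hornerC horner_exp /sqrt_conv horner_sum in E.
have Fk0 : F.[0] ^+ k != 0 by rewrite expf_neq0.
have -> : F^`(k).[0] / k`!%:R =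
    (\sum_(i < k.+1) (sqrt_num i * sqrt_num (k - i)).[0]) * F.[0] / F.[0] ^+ k.
  apply: (mulfI Fk0); rewrite mulrA -E; field; exact/andP.
rewrite !mulr_suml; apply: eq_bigr => i _.
have ik : (i <= k)%N by rewrite -ltnS.
rewrite !coef_poly !ifT ?(leq_ltn_trans _ kN) ?leq_subr // !tE hornerM.
have -> : F.[0] ^+ k = F.[0] ^+ i * F.[0] ^+ (k - i) by rewrite -exprD subnKC.
have u2 : Num.sqrt F.[0] ^+ 2 = F.[0] by rewrite sqr_sqrtr // ltW.
have [i0 j0] := (expf_neq0 i F00, expf_neq0 (k - i) F00).
move: i0 j0; move: (F.[0] ^+ i) (F.[0] ^+ (k - i)) => Fi Fj i0 j0.
by rewrite -[X in _ = _ * X / _]u2; field; rewrite i0 j0.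
Qed.

End SqrtSeries.

(** * The curve of directed tangent lines *)

Lemma le_of_sqr_le (R : realDomainType) (p q : R) :
  p < 0 -> q ^+ 2 <= p ^+ 2 -> p <= q.
Proof.
move=> p0; rewrite [_ <= q]leNgt; apply: contraTN => qp.
rewrite -ltNge -subr_gt0 subr_sqr nmulr_rgt0 ?subr_lt0 //.
by rewrite -[0]addr0 ltrD // (lt_trans qp).
Qed.

Section Lines.
Variables (R : realFieldType) (a B k g : R).

(* In terms of the data of the theorem b = B^2 and beta = a k^2.  The origin of
   the curve is the line that leaves (0, B) with velocity (- g, k), for which
   d = B g; its images under the symmetries of the ellipse are the points of
   order two. *)
Let e := B ^+ 2 - a * k ^+ 2.
Let c := a - B ^+ 2.

(* [line_den] is the polar form of the conic d^2 - c v2^2 = e at the origin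
   (k, B g); [line_slope] is the projection of the conic from this point,
   normalized to take the values of the chord slope at the points of order two. *)
Definition line_den (v2 d : R) := B * g * d - c * k * v2 - e.
Definition line_num (v2 d : R) := B * k * e + B * c * v2 - a * k * g * d.
Definition line_slope (v2 d : R) := line_num v2 d / line_den v2 d.
(** [sum1] and [sum2] are elementary symmetric functions of the roots a, b, beta of the cubic. *)
Definition sum1 := a + B ^+ 2 + a * k ^+ 2.
Definition sum2 := a * B ^+ 2 + a * (a * k ^+ 2) + B ^+ 2 * (a * k ^+ 2).
(* The chord fixes the sum of the abscissas of the two ends of a segment; they are
   exchanged by v1 -> - v1, and their difference vanishes with v1. *)
Definition line_absc (v1 v2 d : R) :=
  (sum1 - line_slope v2 d ^+ 2 + 2 * g * c * e * v1 / line_den v2 d) / 2.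
Definition line_ord (v1 v2 d : R) :=
  a * B * k + line_slope v2 d * line_absc v1 v2 d.

Definition on_caustic (v1 v2 d : R) :=
  v1 ^+ 2 + v2 ^+ 2 = 1 /\ d ^+ 2 = a * v2 ^+ 2 + B ^+ 2 * v1 ^+ 2 - a * k ^+ 2.

(* Selects, on the real curve of directed tangent lines, the component that
   does not contain the origin (v2, d) = (k, B * g). *)
Definition off_origin (v2 d : R) :=
  (0 < e /\ B * g * d < 0) \/ (e < 0 /\ k * v2 < 0).

Hypothesis gk : g ^+ 2 + k ^+ 2 = 1.

Lemma line_abscN v1 v2 d :
  line_absc v1 v2 d + line_absc (- v1) v2 d = sum1 - line_slope v2 d ^+ 2.
Proof. by rewrite /line_absc; lra. Qed.

Lemma on_causticN v1 v2 d : on_caustic v1 v2 d -> on_caustic (- v1) v2 d.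
Proof. by rewrite /on_caustic !sqrrN. Qed.

Section Line.
Variables v1 v2 d : R.
Hypothesis vd : on_caustic v1 v2 d.
Hypothesis den0 : line_den v2 d != 0.

Let hg : g ^+ 2 = 1 - k ^+ 2. Proof. by rewrite -gk addrK. Qed.
Let hv : v1 ^+ 2 = 1 - v2 ^+ 2. Proof. by rewrite -vd.1 addrK. Qed.
Let hd : d ^+ 2 = B ^+ 2 - a * k ^+ 2 + (a - B ^+ 2) * v2 ^+ 2.
Proof. by rewrite vd.2 hv; ring. Qed.

(** With [line_abscN], these are Vieta's formulas for the chord of slope [line_slope v2 d] through
    (0, a B k). The identity [I] is the claim cleared of denominators, modulo the three quadratic
    relations. *)
Lemma line_abscM :
  line_absc v1 v2 d * line_absc (- v1) v2 d
  = sum2 + 2 * (a * B * k) * line_slope v2 d.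
Proof.
pose D := line_den v2 d; pose N := line_num v2 d.
have I : (sum1 * D ^+ 2 - N ^+ 2) ^+ 2 - (2 * g * c * e * v1 * D) ^+ 2
    = 4 * D ^+ 3 * (sum2 * D + 2 * (a * B * k) * N).
  rewrite /D /N /sum1 /sum2 /line_den /line_num /e /c; ring: hv hd hg.
rewrite /line_absc /line_slope -/D -/N; have D0 : D != 0 := den0.
have D4 : 4 * D ^+ 4 != 0 by rewrite mulf_neq0 ?expf_neq0 // pnatr_eq0.
apply: (mulfI D4); transitivity (4 * D ^+ 3 * (sum2 * D + 2 * (a * B * k) * N));
  last by field.
by rewrite -I; field.
Qed.

(* The segment starts at the point (x, B Y) of the ellipse.  By the next lemmas
   the abscissa and the ordinate of the line depend only on x, Y and on T, which
   is proportional to the tangential velocity. *)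
Section Hit.
Variables x Y : R.
Hypothesis hit1 : B * v1 * x + a * v2 * Y = a * k.
Hypothesis hit2 : v2 * x - B * v1 * Y = d.
Hypothesis sg_gt0 : 0 < B ^+ 2 * v1 ^+ 2 + a * v2 ^+ 2.

Let T := B * v2 * x - a * v1 * Y.
Let sg := B ^+ 2 * v1 ^+ 2 + a * v2 ^+ 2.

(** Cramer's rule for the system [hit1], [hit2], whose determinant is [- sg]. *)
Let sgx : sg * x = a * (B * k * v1 + v2 * d).
Proof. rewrite /sg -hit2; apply: (eq_lin (c := B * v1) hit1); ring. Qed.

Let sgY : sg * Y = a * k * v2 - B * d * v1.
Proof. rewrite /sg -hit2; apply: (eq_lin (c := v2) hit1); ring. Qed.

Let sgT : sg * T = a * (B * d - k * c * v1 * v2).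
Proof.
have -> : sg * T = B * v2 * (sg * x) - a * v1 * (sg * Y) by rewrite /T; ring.
by rewrite sgx sgY /c; ring: hv.
Qed.

Let sgE : sg = d ^+ 2 + a * k ^+ 2.
Proof. by rewrite vd.2 /sg; ring. Qed.

Definition hit_den := g * T - c * Y - e.
Definition hit_num := - a * e - a * k ^+ 2 * c * Y + B ^+ 2 * g * T.

Let sgD : sg * hit_den =
  g * (a * (B * d - k * c * v1 * v2)) - c * (a * k * v2 - B * d * v1) - e * sg.
Proof. by rewrite -sgT -sgY /hit_den; ring. Qed.

Let sgN : sg * hit_num =
  - a * e * sg - a * k ^+ 2 * c * (a * k * v2 - B * d * v1)
  + B ^+ 2 * g * (a * (B * d - k * c * v1 * v2)).
Proof. by rewrite -sgT -sgY /hit_num; ring. Qed.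

Let sg0 : sg != 0. Proof. by rewrite gt_eqF. Qed.

Lemma hit_absc : line_absc v1 v2 d * hit_den = hit_num.
Proof.
pose D := line_den v2 d; pose N := line_num v2 d.
have I : (sum1 * D ^+ 2 - N ^+ 2 + 2 * g * c * e * v1 * D) * (sg * hit_den)
    = 2 * D ^+ 2 * (sg * hit_num).
  rewrite sgD sgN sgE /D /N /sum1 /line_den /line_num /e /c; ring: hv hd hg.
rewrite /line_absc /line_slope -/D -/N; have D0 : D != 0 := den0.
have D2 : 2 * D ^+ 2 * sg != 0 by rewrite !mulf_neq0 ?expf_neq0 // pnatr_eq0.
apply: (mulfI D2).
transitivity ((sum1 * D ^+ 2 - N ^+ 2 + 2 * g * c * e * v1 * D) * (sg * hit_den)).
  by field.
by rewrite I; ring.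
Qed.

Lemma hit_ord : line_ord v1 v2 d * hit_den = - g * c * e * x.
Proof.
pose D := line_den v2 d; pose N := line_num v2 d.
have I : a * B * k * D * (sg * hit_den) + N * (sg * hit_num)
    = - g * c * e * D * (sg * x).
  rewrite sgD sgN sgx sgE /D /N /line_den /line_num /e /c; ring: hv hd hg.
rewrite /line_ord mulrDl -[line_slope _ _ * _ * _]mulrA hit_absc /line_slope -/D -/N.
have D0 : D != 0 := den0.
have Dsg : D * sg != 0 by rewrite mulf_neq0.
apply: (mulfI Dsg).
transitivity (a * B * k * D * (sg * hit_den) + N * (sg * hit_num)); first by field.
by rewrite I; ring.
Qed.

Hypothesis a_gt0 : 0 < a.
Hypothesis c_gt0 : 0 < c.

Let g_neq0 : 0 < a * g ^+ 2 -> g != 0.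
Proof. by apply: contraTneq => ->; rewrite expr0n mulr0 ltxx. Qed.

Let ag : a * g ^+ 2 = c + e. Proof. by rewrite hg /c /e; ring. Qed.

Lemma sign_hit_T : 0 < e -> 0 < B * d * T.
Proof.
move=> e0; rewrite -(pmulr_rgt0 _ sg_gt0) -/sg.
pose p := B * d; pose q := k * c * v1 * v2.
have -> : sg * (B * d * T) = a * (p ^+ 2 - p * q).
  by rewrite /p /q; apply: (eq_lin (c := B * d) sgT); ring.
rewrite pmulr_rgt0 //.
have h : p ^+ 2 - q ^+ 2 = B ^+ 2 * e
    + (e * (c * v2 ^+ 2) + (k * v2) ^+ 2 * c * (B ^+ 2 + c * v2 ^+ 2)).
  rewrite /p /q /e /c; ring: hv hd.
have B2 : 0 < B ^+ 2.
  have -> : B ^+ 2 = e + a * k ^+ 2 by rewrite /e; ring.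
  by apply: ltr_wpDr => //; rewrite mulr_ge0 ?sqr_ge0 // ltW.
have h1 : 0 < B ^+ 2 * e by rewrite mulr_gt0.
have cv : 0 <= c * v2 ^+ 2 := mulr_ge0 (ltW c_gt0) (sqr_ge0 _).
have h2 : 0 <= e * (c * v2 ^+ 2) := mulr_ge0 (ltW e0) cv.
have h3 : 0 <= (k * v2) ^+ 2 * c * (B ^+ 2 + c * v2 ^+ 2).
  exact: mulr_ge0 (mulr_ge0 (sqr_ge0 _) (ltW c_gt0)) (addr_ge0 (sqr_ge0 _) cv).
(* Twice [p ^+ 2 - p * q] is the sum of [p ^+ 2 - q ^+ 2] and [(p - q) ^+ 2]. *)
have := sqr_ge0 (p - q); lra.
Qed.

Lemma sign_hit_Y : e < 0 -> 0 < k * v2 * Y.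
Proof.
move=> e0; have asg : 0 < a * sg by rewrite mulr_gt0.
rewrite -(pmulr_rgt0 _ asg).
pose p := a * k * v2; pose q := B * d * v1.
have -> : a * sg * (k * v2 * Y) = p ^+ 2 - p * q.
  by rewrite /p /q; apply: (eq_lin (c := a * k * v2) sgY); ring.
have h : p ^+ 2 - q ^+ 2 = - e * sg + (B * v2) ^+ 2 * (B ^+ 2 + c * v2 ^+ 2).
  rewrite /p /q /sg /e /c; ring: hv hd.
have h1 : 0 < - e * sg by rewrite mulr_gt0 // oppr_gt0.
have h3 : 0 <= (B * v2) ^+ 2 * (B ^+ 2 + c * v2 ^+ 2).
  apply: mulr_ge0 (sqr_ge0 _) (addr_ge0 (sqr_ge0 _) _).
  exact: mulr_ge0 (ltW c_gt0) (sqr_ge0 _).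
have := sqr_ge0 (p - q); lra.
Qed.

(** Reads the component off the boundary data, so that it can be carried through a bounce. *)
Lemma off_origin_hit :
  off_origin v2 d <-> (0 < e /\ g * T < 0) \/ (e < 0 /\ Y < 0).
Proof.
have same (u w : R) : 0 < u * w -> (u < 0) = (w < 0).
  move=> uw; apply/idP/idP => h.
    by rewrite ltNge; apply/negP => w0; move: uw; rewrite ltNge nmulr_rle0 ?w0.
  by rewrite ltNge; apply/negP => u0; move: uw; rewrite ltNge nmulr_lle0 ?u0.
have E1 : 0 < e -> (B * g * d < 0) = (g * T < 0).
  move=> e0; have g0 : g != 0 by apply: g_neq0; rewrite ag addr_gt0.
  apply: same; rewrite (_ : _ * _ = g ^+ 2 * (B * d * T)); last by ring.
  by rewrite mulr_gt0 ?sign_hit_T // exprn_even_gt0.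
have E2 : e < 0 -> (k * v2 < 0) = (Y < 0) by move=> e0; apply/same/sign_hit_Y.
by split=> -[[e0 h]|[e0 h]]; [left|right|left|right]; split=> //;
  rewrite ?E1 ?E2 // -?E1 -?E2.
Qed.

(** A zero would mean g T - c Y = e. On the chosen component the comparison of squares gives g T <=
    c Y if e > 0, and the reverse if e < 0. The same argument proves [line_den_neq0]. *)
Lemma hit_den_neq0 :
  x ^+ 2 = a * (1 - Y ^+ 2) -> off_origin v2 d -> hit_den != 0.
Proof.
move=> xY /off_origin_hit adm.
have T2 : T ^+ 2 = a * (c * Y ^+ 2 + e).
  have : T ^+ 2 + (a * k) ^+ 2 = B ^+ 2 * x ^+ 2 + a ^+ 2 * Y ^+ 2.
    rewrite -hit1 /T; ring: hv.
  by rewrite xY /e /c => h; apply: (eq_lin (c := 1) h); ring.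
have gT2 : (g * T) ^+ 2 = (c + e) * (c * Y ^+ 2 + e).
  by rewrite exprMn T2 -ag; ring.
have cY : 0 <= c * Y ^+ 2 := mulr_ge0 (ltW c_gt0) (sqr_ge0 _).
rewrite /hit_den; case: adm => -[e0 h].
  suff : g * T <= c * Y by move=> ?; rewrite lt_eqF //; lra.
  apply: le_of_sqr_le h _; rewrite gT2 exprMn.
  have h1 : 0 <= e * (c * Y ^+ 2 + c + e).
    by apply: mulr_ge0; [exact: ltW|have := ltW e0; have := ltW c_gt0; lra].
  by rewrite -subr_ge0; apply: le_trans h1 _; rewrite le_eqVlt; apply/orP; left; apply/eqP; ring.
have Tp : 0 <= c * Y ^+ 2 + e by rewrite -(pmulr_rge0 _ a_gt0) -T2 sqr_ge0.
have cp : 0 <= c + e by rewrite -ag; exact: mulr_ge0 (ltW a_gt0) (sqr_ge0 _).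
suff : c * Y <= g * T by move=> ?; rewrite gt_eqF //; lra.
apply: le_of_sqr_le; first by rewrite pmulr_rlt0.
rewrite gT2 exprMn.
have -> : c ^+ 2 * Y ^+ 2 = c * (c * Y ^+ 2) by ring.
by apply: ler_pM => //; lra.
Qed.

End Hit.

Hypothesis a_gt0 : 0 < a.
Hypothesis c_gt0 : 0 < c.

Lemma line_den_neq0 : off_origin v2 d -> line_den v2 d != 0.
Proof.
move=> adm.
have X2 : (B * g * d) ^+ 2 = (e + c * k ^+ 2) * (e + c * v2 ^+ 2).
  rewrite /e /c; ring: hd hg.
have ck : 0 <= c * k ^+ 2 := mulr_ge0 (ltW c_gt0) (sqr_ge0 _).
have cv : 0 <= c * v2 ^+ 2 := mulr_ge0 (ltW c_gt0) (sqr_ge0 _).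
have ckv : (c * k * v2) ^+ 2 = (c * k ^+ 2) * (c * v2 ^+ 2) by ring.
rewrite /line_den; case: adm => -[e0 h].
  suff : B * g * d <= c * k * v2 by move=> ?; rewrite lt_eqF //; lra.
  by apply: le_of_sqr_le h _; rewrite X2 ckv ler_pM //; lra.
have dp : 0 <= e + c * v2 ^+ 2.
  by rewrite (_ : _ + _ = d ^+ 2) ?sqr_ge0 // hd /e /c.
have Bp : 0 <= e + c * k ^+ 2.
  by rewrite (_ : _ + _ = (B * g) ^+ 2) ?sqr_ge0 // exprMn hg /e /c; ring.
suff : c * k * v2 <= B * g * d by move=> ?; rewrite gt_eqF //; lra.
apply: le_of_sqr_le; first by rewrite -mulrA pmulr_rlt0.
by rewrite X2 ckv ler_pM //; lra.
Qed.

End Line.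

(** The old line with [v1] negated passes through (- x, B Y), with the same Y and T as the new line
    at (x, B Y). Hence the abscissas agree, while the ordinates, proportional to the first
    coordinate, are opposite. *)
Lemma line_step (v1 v2 d w1 w2 d' x Y : R) :
    0 < a -> 0 < c -> B != 0 -> x ^+ 2 = a * (1 - Y ^+ 2) ->
    on_caustic v1 v2 d -> on_caustic w1 w2 d' -> off_origin v2 d ->
    B * v1 * x + a * v2 * Y = a * k -> v2 * x - B * v1 * Y = - d ->
    B * w1 * x + a * w2 * Y = a * k -> w2 * x - B * w1 * Y = d' ->
    B * w2 * x - a * w1 * Y = - (B * v2 * x - a * v1 * Y) ->
  [/\ off_origin w2 d', line_absc w1 w2 d' = line_absc (- v1) v2 d
    & line_ord w1 w2 d' = - line_ord (- v1) v2 d].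
Proof.
move=> a0 c0 B0 xY vd wd adm h1 h2 h1' h2' hT.
have sg_gt0 u1 u2 d0 : on_caustic u1 u2 d0 -> 0 < B ^+ 2 * u1 ^+ 2 + a * u2 ^+ 2.
  move=> [hu _]; have B2 : 0 < B ^+ 2 by rewrite exprn_even_gt0.
  have -> : B ^+ 2 * u1 ^+ 2 + a * u2 ^+ 2 = B ^+ 2 + c * u2 ^+ 2.
    by rewrite -[B ^+ 2 in RHS]mulr1 -hu /c; ring.
  exact: ltr_pwDl B2 (mulr_ge0 (ltW c0) (sqr_ge0 _)).
have vd' := on_causticN vd.
have g1 : B * - v1 * - x + a * v2 * Y = a * k by rewrite -h1; ring.
have g2 : v2 * - x - B * - v1 * Y = d by rewrite -[d]opprK -h2; ring.
have xY' : (- x) ^+ 2 = a * (1 - Y ^+ 2) by rewrite sqrrN.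
have sgv := sg_gt0 _ _ _ vd'; have sgw := sg_gt0 _ _ _ wd.
have TE : B * v2 * - x - a * - v1 * Y = B * w2 * x - a * w1 * Y by rewrite hT; ring.
have adm' : off_origin w2 d'.
  apply/(off_origin_hit wd h1' h2' sgw a0 c0); rewrite -TE.
  exact/(off_origin_hit vd' g1 g2 sgv a0 c0).
have D0 := line_den_neq0 vd c0 adm; have D0' := line_den_neq0 wd c0 adm'.
have E0 := hit_den_neq0 wd h1' h2' sgw a0 c0 xY adm'.
have A1 := hit_absc vd' D0 g1 g2 sgv; have A2 := hit_absc wd D0' h1' h2' sgw.
have O1 := hit_ord vd' D0 g1 g2 sgv; have O2 := hit_ord wd D0' h1' h2' sgw.
rewrite /hit_num /hit_den TE in A1 O1; rewrite /hit_num /hit_den in A2 O2 E0.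
by split=> //; apply: (mulIf E0); rewrite ?mulNr ?A1 ?A2 ?O1 ?O2 //; ring.
Qed.

(** A line through a point of a conic meets it in at most one further point, so the slope determines
    [v2] and [d]; the abscissa then determines [v1]. *)
Lemma line_inj (v1 v2 d w1 w2 d' : R) :
    on_caustic v1 v2 d -> on_caustic w1 w2 d' ->
    line_den v2 d != 0 -> line_den w2 d' != 0 -> g * c * e * k != 0 ->
    line_slope v2 d = line_slope w2 d' -> line_absc v1 v2 d = line_absc w1 w2 d' ->
  [/\ v1 = w1, v2 = w2 & d = d'].
Proof.
move=> [hv hd] [hw hd'] D0 D0' nz slE abE.
have hg : g ^+ 2 = 1 - k ^+ 2 by rewrite -gk addrK.
have [ed ed'] : d ^+ 2 = e + c * v2 ^+ 2 /\ d' ^+ 2 = e + c * w2 ^+ 2.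
  by rewrite hd hd' /e /c -[v1 ^+ 2](addrK (v2 ^+ 2)) hv
    -[w1 ^+ 2](addrK (w2 ^+ 2)) hw; split; ring.
suff [E2 Ed] : v2 = w2 /\ d = d'.
  split=> //; rewrite -E2 -Ed in abE.
  have q0 : 2 * g * c * e / line_den v2 d != 0.
    rewrite !mulf_neq0 ?invr_eq0 ?pnatr_eq0 //; move: nz;
      by rewrite !mulf_eq0 !negb_or => /andP[/andP[/andP[]]].
  apply: (mulfI q0); move: abE; rewrite /line_absc.
  by rewrite ![_ * _ / line_den _ _]mulrAC => ?; lra.
pose p := v2 - k; pose q := d - B * g; pose p' := w2 - k; pose q' := d' - B * g.
pose D := B * g * q - c * k * p; pose D' := B * g * q' - c * k * p'.
have [DE DE'] : line_den v2 d = D /\ line_den w2 d' = D'.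
  by split; rewrite /line_den /D /D' /q /q' /p /p' /e /c; ring: hg.
have [NE NE'] : line_num v2 d = B * c * p - a * k * g * q
    /\ line_num w2 d' = B * c * p' - a * k * g * q'.
  by split; rewrite /line_num /q /q' /p /p' /e /c; ring: hg.
rewrite DE DE' in D0 D0'.
have [cE cE'] : q ^+ 2 - c * p ^+ 2 = - 2 * D /\ q' ^+ 2 - c * p' ^+ 2 = - 2 * D'.
  by split; rewrite /D /D' /q /q' /p /p'; [apply: (eq_lin (c := 1) ed)|
    apply: (eq_lin (c := 1) ed')]; rewrite /e /c; ring: hg.
(* Numerator and denominator of the slope are linear forms in (p, q) of determinant g c e, so equal
   slopes make the two vectors proportional. *)
have pq : p * q' = p' * q.
  have gce : g * c * e != 0 by move: nz; rewrite mulf_eq0 negb_or => /andP[].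
  apply: (mulfI gce).
  have : line_num v2 d * D' = line_num w2 d' * D.
    move: slE; rewrite /line_slope DE DE' => /(congr1 (fun r => r * D * D')).
    by rewrite mulfVK // => ->; rewrite mulrAC mulfVK.
  by rewrite NE NE' => h; apply: (eq_lin (c := 1) h); rewrite /D /D' /e /c; ring.
(* The polar form of q^2 - c p^2 = - 2 D; multiplying by it identifies the two proportional
   vectors. *)
pose X := q * q' - c * p * p'.
have x1 : p * X = - 2 * D * p'.
  by rewrite -cE /X; apply: (eq_lin (c := q) pq); ring.
have x2 : p' * X = - 2 * D * p'.
  rewrite (_ : - 2 * D * p' = - 2 * D' * p).
    by rewrite -cE' /X; apply: (eq_lin (c := - q') pq); ring.
  by rewrite /D /D'; apply: (eq_lin (c := 2 * B * g) pq); ring.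
have x3 : q * X = - 2 * D * q'.
  by rewrite -cE /X; apply: (eq_lin (c := c * p) pq); ring.
have x4 : q' * X = - 2 * D * q'.
  rewrite (_ : - 2 * D * q' = - 2 * D' * q).
    by rewrite -cE' /X; apply: (eq_lin (c := - c * p') pq); ring.
  by rewrite /D /D'; apply: (eq_lin (c := 2 * c * k) pq); ring.
have X0 : X != 0.
  apply: contraNneq D0' => X0; rewrite X0 !mulr0 in x1 x3.
  have D2 : - 2 * D != 0 by rewrite mulf_neq0 ?oppr_eq0 ?pnatr_eq0.
  have p0 : p' = 0 by apply: (mulfI D2); rewrite -x1 mulr0.
  have q0 : q' = 0 by apply: (mulfI D2); rewrite -x3 mulr0.
  by rewrite /D' p0 q0 !mulr0 subr0.
have pE : p = p' by apply: (mulIf X0); rewrite x1 x2.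
have qE : q = q' by apply: (mulIf X0); rewrite x3 x4.
by split; [apply: (addIr (- k))|apply: (addIr (- (B * g)))].
Qed.
End Lines.

(** * Billiard dynamics *)

Section Dynamics.
Variables (R : realType) (a b beta : R).
Hypotheses (b_gt0 : 0 < b) (ba : b < a) (beta_gt0 : 0 < beta).
Hypotheses (beta_a : beta != a) (beta_b : beta != b).

Let a_gt0 : 0 < a := lt_trans b_gt0 ba.
Let a0 : a != 0. Proof. by rewrite gt_eqF. Qed.
Let b0 : b != 0. Proof. by rewrite gt_eqF. Qed.

Definition offset (P v : R * R) : R := v.2 * P.1 - v.1 * P.2.

(** The value of the Joachimsthal integral. It is negative because the normal is taken at the
    half-turned hit point, where an outgoing velocity points inward. *)
Definition joachimsthal : R := - Num.sqrt (beta / (a * b)).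

Lemma joachimsthal_sqr : joachimsthal ^+ 2 = beta / (a * b).
Proof. by rewrite sqrrN sqr_sqrtr // divr_ge0 ?mulr_ge0 ?ltW. Qed.

Lemma joachimsthal_lt0 : joachimsthal < 0.
Proof. by rewrite oppr_lt0 sqrtr_gt0 divr_gt0 // mulr_gt0. Qed.

(** The dual conic: (X', Y') is a multiple [c] of the normal (v2, - v1), Z is [c] times the offset,
    and [c] is nonzero since (X : Y : Z) is a point. *)
Lemma tangent_offset (P v : R * R) : dot v v = 1 ->
  tangent_to_confocal a b beta P v ->
  offset P v ^+ 2 = a * v.2 ^+ 2 + b * v.1 ^+ 2 - beta.
Proof.
case: P v => [x y] [p q]; rewrite /dot /offset /= => nv [X [Y [Z [nz h1 h2 h3]]]].
have al : a - beta != 0 by rewrite subr_eq0 eq_sym.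
have bl : b - beta != 0 by rewrite subr_eq0 eq_sym.
pose X' := X / (a - beta); pose Y' := Y / (b - beta).
have EX : X = (a - beta) * X' by rewrite mulrC divfK.
have EY : Y = (b - beta) * Y' by rewrite mulrC divfK.
pose c := q * X' - p * Y'.
have h3' : p * X' + q * Y' = 0 by rewrite -h3 !mulrA.
have cX : X' = c * q.
  rewrite -[LHS]mul1r -nv /c; apply: (eq_lin (c := p) h3'); ring.
have cY : Y' = - c * p.
  rewrite -[LHS]mul1r -nv /c; apply: (eq_lin (c := q) h3'); ring.
have EZ : Z = c * (q * x - p * y).
  rewrite -h2 -!mulrA -/X' -/Y' cX cY /=; ring.
have c0 : c != 0.
  apply/eqP => cz; apply: nz.
  by rewrite EX EY EZ cX cY cz oppr0 !mul0r !mulr0.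
have c2 : c ^+ 2 != 0 by rewrite expf_neq0.
apply: (mulfI c2).
have : (a - beta) * X' ^+ 2 + (b - beta) * Y' ^+ 2 = Z ^+ 2.
  rewrite -h1 EX EY; field; exact/andP.
rewrite cX cY EZ => h.
have nv' : c ^+ 2 * beta = c ^+ 2 * beta * (p * p + q * q) by rewrite nv mulr1.
by apply: (eq_lin (c := - 1) h); rewrite !mulrBr nv'; ring.
Qed.

Lemma in_table_dot (P Q : R * R) : in_table a b P -> on_ellipse a b Q ->
  dot P (ellipse_normal a b Q) <= 1.
Proof.
case: P Q => [x y] [X Y]; rewrite /in_table /on_ellipse /dot /ellipse_normal /=.
move=> h1 h2.
have h3 : 0 <= (x - X) ^+ 2 / a + (y - Y) ^+ 2 / b.
  by rewrite addr_ge0 // divr_ge0 ?sqr_ge0 ?ltW.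
have E : (x - X) ^+ 2 / a + (y - Y) ^+ 2 / b =
   (x ^+ 2 / a + y ^+ 2 / b) + (X ^+ 2 / a + Y ^+ 2 / b) - 2 * (x * (X / a) + y * (Y / b)).
  by field; rewrite a0 b0.
by rewrite E h2 in h3; lra.
Qed.

(** Rests on (b p x + a q y)^2 + a b (q x - p y)^2 = (b p^2 + a q^2)(b x^2 + a y^2). *)
Lemma ellipse_dot_sqr (Q v : R * R) : on_ellipse a b Q -> dot v v = 1 ->
    offset Q v ^+ 2 = a * v.2 ^+ 2 + b * v.1 ^+ 2 - beta ->
  dot v (ellipse_normal a b Q) ^+ 2 = joachimsthal ^+ 2.
Proof.
case: Q v => [x y] [p q]; rewrite /on_ellipse /dot /offset /ellipse_normal /=.
move=> h nv hd; rewrite joachimsthal_sqr.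
have h' : b * x ^+ 2 + a * y ^+ 2 = a * b.
  by rewrite -[RHS]mulr1 -h; field; rewrite a0 b0.
have ab : (a * b) ^+ 2 != 0 by rewrite expf_neq0 // mulf_neq0.
apply: (mulfI ab).
transitivity ((b * p * x + a * q * y) ^+ 2); first by field; rewrite a0 b0.
transitivity (a * b * beta); last by field; rewrite a0 b0.
have -> : beta = a * q ^+ 2 + b * p ^+ 2 - (q * x - p * y) ^+ 2 by rewrite hd; ring.
by apply: (eq_lin (c := a * q ^+ 2 + b * p ^+ 2) h'); ring.
Qed.

Variables P v : nat -> R * R.
Hypothesis traj : magic_trajectory a b P v.
Hypothesis caustic : has_caustic a b beta P v.

Let normal_neq0 (Q : R * R) : on_ellipse a b Q ->
  (Q.1 / a) ^+ 2 + (Q.2 / b) ^+ 2 != 0.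
Proof.
rewrite /on_ellipse => hQ; apply/negP.
rewrite paddr_eq0 ?sqr_ge0 // !expf_eq0 /= !mulf_eq0 !invr_eq0.
rewrite (negbTE a0) (negbTE b0) !orbF => /andP[/eqP q1 /eqP q2].
by move: hQ; rewrite q1 q2 expr0n !mul0r addr0 => /eqP; rewrite eq_sym oner_eq0.
Qed.

Lemma half_turn_reflectE (Q u : R * R) : on_ellipse a b Q ->
  let r := 2 * (u.1 * (Q.1 / a) + u.2 * (Q.2 / b)) /
    ((Q.1 / a) ^+ 2 + (Q.2 / b) ^+ 2) in
  half_turn (reflect_at a b Q u) =
  (r * (Q.1 / a) - u.1, r * (Q.2 / b) - u.2).
Proof.
move=> hQ r; have m0 := normal_neq0 hQ.
rewrite /half_turn /reflect_at /dot /ellipse_normal /= -!expr2 mulrA -/r.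
by apply: injective_projections; rewrite /= opprB.
Qed.

Lemma reflect_norm (Q u : R * R) : on_ellipse a b Q ->
  dot (half_turn (reflect_at a b Q u)) (half_turn (reflect_at a b Q u)) = dot u u.
Proof.
move=> hQ; have m0 := normal_neq0 hQ; rewrite half_turn_reflectE // /dot /=.
move: m0; move: (Q.1 / a) (Q.2 / b) => m1 m2 m0; by field.
Qed.

Lemma velocity_norm i : dot (v i) (v i) = 1.
Proof.
case: traj => _ v0 hits_i; elim: i => [//|i IH].
by have [Q [[t [_ _ hQ]] _ ->]] := hits_i i; rewrite reflect_norm.
Qed.

Lemma position_table i : in_table a b (P i).
Proof.
case: traj => P0 _ hits_i; case: i => [//|i].
have [Q [[t [_ _ hQ]] -> _]] := hits_i i.
by rewrite /in_table /= !sqrrN; rewrite hQ.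
Qed.

Lemma offset_sqr i :
  offset (P i) (v i) ^+ 2 = a * (v i).2 ^+ 2 + b * (v i).1 ^+ 2 - beta.
Proof. exact: tangent_offset (velocity_norm i) (caustic i). Qed.

(** The square of the integral is known; its sign follows from [in_table_dot], as the segment
    reaches the ellipse from inside the table. *)
Lemma bounce i : let Q := P i.+1 in
  [/\ on_ellipse a b Q,
      dot (v i) (ellipse_normal a b Q) = joachimsthal,
      dot (v i.+1) (ellipse_normal a b Q) = joachimsthal,
      offset Q (v i) = - offset (P i) (v i) &
      (v i.+1).2 * (Q.1 / a) - (v i.+1).1 * (Q.2 / b) =
      - ((v i).2 * (Q.1 / a) - (v i).1 * (Q.2 / b))].
Proof.
have [_ _ /(_ i)[Q [[t [t0 QE hQ]] -> ->]]] := traj.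
have nv := velocity_norm i; have hP := in_table_dot (position_table i) hQ.
have m0 := normal_neq0 hQ.
have offE : offset Q (v i) = offset (P i) (v i).
  by rewrite QE /offset; case: (P i) (v i) => [? ?] [? ?] /=; rewrite /GRing.scale /=; ring.
have hd := offset_sqr i; rewrite -offE in hd.
have /eqP := ellipse_dot_sqr hQ nv hd.
have tE : t * dot (v i) (ellipse_normal a b Q) =
    1 - dot (P i) (ellipse_normal a b Q).
  have : dot Q (ellipse_normal a b Q) = 1.
    by rewrite -[RHS]hQ /dot /ellipse_normal /= !mulrA -!expr2.
  rewrite {1}QE /dot; case: (P i) (v i) => [? ?] [? ?] /= <-.
  by rewrite /GRing.scale /=; ring.
have pos : 0 <= dot (v i) (ellipse_normal a b Q).
  by rewrite -(pmulr_rge0 _ t0) tE subr_ge0.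
have Jlt := joachimsthal_lt0.
rewrite eqf_sqr => /orP[/eqP E|/eqP E]; first by rewrite E in pos; lra.
rewrite half_turn_reflectE // /half_turn /dot /offset /ellipse_normal /on_ellipse.
rewrite /dot /ellipse_normal /= in E.
rewrite /= !sqrrN !mulrN !mulNr.
split=> //; first by rewrite -[RHS]opprK -E; ring.
- rewrite -[RHS]opprK -E; move: m0.
  by move: (Q.1 / a) (Q.2 / b) => m1 m2 m0; field.
- by move: offE; rewrite /offset => <-; ring.
- by move: m0; move: (Q.1 / a) (Q.2 / b) => m1 m2 m0; field.
Qed.

(** Periodicity is the return of the directed line. The parameter [t] is then nonnegative because
    the initial point lies in the table and the velocity points inward at [P n]. *)
Lemma periodic_iff n : (0 < n)%N ->
  n_periodic n P v <->
  v n = v 0%N /\ offset (P n) (v n) = offset (P 0%N) (v 0%N).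
Proof.
case: n => // n _; rewrite /n_periodic; split=> -[vE h]; split=> //.
  case: h => t [_ ->]; rewrite vE /offset.
  by case: (P n.+1) (v 0%N) => [? ?] [? ?] /=; rewrite /GRing.scale /=; ring.
have [hQ _ hJ _ _] := bounce n.
have hP := in_table_dot (position_table 0) hQ.
have nv := velocity_norm 0; have Jlt := joachimsthal_lt0.
rewrite vE in h hJ *.
pose t := ((P 0%N).1 - (P n.+1).1) * (v 0%N).1 + ((P 0%N).2 - (P n.+1).2) * (v 0%N).2.
have PE : P 0%N = P n.+1 + t *: v 0%N.
  move: nv h; rewrite /t /dot /offset.
  case: (P n.+1) (P 0%N) (v 0%N) => [x y] [x' y'] [p q] /= nv h.
  apply: injective_projections; rewrite /= /GRing.scale /=.
    by apply: (eq_lin (c := (x - x')) nv); apply: (eq_lin (c := - q) h); ring.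
  by apply: (eq_lin (c := (y - y')) nv); apply: (eq_lin (c := p) h); ring.
clearbody t; exists t; split=> //.
have tJ : t * joachimsthal = dot (P 0%N) (ellipse_normal a b (P n.+1)) - 1.
  have <- : dot (P n.+1) (ellipse_normal a b (P n.+1)) = 1.
    by rewrite -[RHS]hQ /dot /ellipse_normal /= !mulrA -!expr2.
  rewrite -hJ PE.
  rewrite /dot; case: (P n.+1) (v 0%N) => [? ?] [? ?] /=.
  by rewrite /GRing.scale /=; ring.
rewrite leNgt; apply/negP => t_lt0.
by have := nmulr_rgt0 joachimsthal t_lt0; rewrite tJ Jlt subr_gt0 ltNge hP.
Qed.

End Dynamics.

(** * Choice of the origin of the curve, and conclusion *)

Lemma exists_sqrt_neg (R : rcfType) (r z : R) : 0 < r -> z != 0 ->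
  exists2 q : R, q ^+ 2 = r & q * z < 0.
Proof.
move=> r0 z0; have s0 : 0 < Num.sqrt r by rewrite sqrtr_gt0.
have [zn|zp] := ltP z 0.
  by exists (Num.sqrt r); rewrite ?sqr_sqrtr ?ltW // pmulr_rlt0.
exists (- Num.sqrt r); first by rewrite sqrrN sqr_sqrtr // ltW.
by rewrite mulNr oppr_lt0 mulr_gt0 // lt_def z0.
Qed.

(** The signs of B and g are free. For an elliptic caustic d is nonzero, and the sign of g is chosen
    against it; for a hyperbolic one v2 is nonzero, and the sign of B, hence of k, is chosen. *)
Lemma exists_origin (R : realType) (a b beta v1 v2 d : R) :
    0 < b -> b < a -> 0 < beta < b \/ b < beta < a ->
    v1 ^+ 2 + v2 ^+ 2 = 1 -> d ^+ 2 = a * v2 ^+ 2 + b * v1 ^+ 2 - beta ->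
  exists B g : R, let k := joachimsthal a b beta * B in
    [/\ B ^+ 2 = b, a * k ^+ 2 = beta, g ^+ 2 + k ^+ 2 = 1
      & off_origin a B k g v2 d].
Proof.
move=> b0 ba hbeta nv hd; have a0 := lt_trans b0 ba.
have beta0 : 0 < beta by case: hbeta => /andP[h ?] //; exact: lt_trans h.
have beta_a : beta < a by case: hbeta => /andP[? h] //; exact: lt_trans ba.
set J := joachimsthal a b beta.
have J0 : J < 0 := joachimsthal_lt0 b0 ba beta0.
have kE B : B ^+ 2 = b -> (J * B) ^+ 2 = beta / a.
  move=> hB; rewrite exprMn hB joachimsthal_sqr //.
  by field; rewrite !gt_eqF.
have akE B : B ^+ 2 = b -> a * (J * B) ^+ 2 = beta.
  by move=> /kE ->; rewrite mulrCA mulfV ?mulr1 // gt_eqF.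
have g0 : 0 < 1 - beta / a by rewrite subr_gt0 ltr_pdivrMr ?mul1r.
have dE : d ^+ 2 = (b - beta) + (a - b) * v2 ^+ 2.
  by rewrite hd; apply: (eq_lin (c := b) nv); ring.
have cv : 0 <= (a - b) * v2 ^+ 2.
  by rewrite mulr_ge0 ?sqr_ge0 // subr_ge0 ltW.
case: hbeta => /andP[h1 h2].
  have d0 : d != 0.
    apply: contraTneq (ltr_pwDl (_ : 0 < b - beta) cv) => [dz|]; last by rewrite subr_gt0.
    by rewrite -dE dz expr0n ltxx.
  have hB : Num.sqrt b ^+ 2 = b by rewrite sqr_sqrtr // ltW.
  have Bd : Num.sqrt b * d != 0 by rewrite mulf_neq0 // gt_eqF // sqrtr_gt0.
  have [g gE gl] := exists_sqrt_neg g0 Bd.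
  exists (Num.sqrt b), g; split; rewrite ?akE //; first by rewrite gE kE ?subrK.
  left; rewrite akE // hB subr_gt0; split=> //.
  by rewrite [_ * g]mulrC -mulrA.
have v0 : v2 != 0.
  apply: contraTneq (sqr_ge0 d) => vz.
  by rewrite dE vz expr0n mulr0 addr0 -ltNge subr_lt0.
have [B hB Bl] := exists_sqrt_neg b0 (mulf_neq0 (ltr0_neq0 J0) v0).
exists B, (Num.sqrt (1 - beta / a)); split; rewrite ?akE //.
  by rewrite kE // sqr_sqrtr ?subrK // ltW.
by right; rewrite akE // hB subr_lt0 mulrAC [_ * B]mulrC.
Qed.

Lemma cubic_factor (R : realFieldType) (a b beta s z : R) : s ^+ 2 = a * b * beta ->
  (cubic (a + b + beta) (a * b + a * beta + b * beta) s).[z]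
  = (a - z) * (b - z) * (beta - z).
Proof. by move=> sE; rewrite cubic_horner sE; ring. Qed.

Lemma cubic_simple_roots (R : realFieldType) (a b beta s z : R) :
    s ^+ 2 = a * b * beta -> a != b -> a != beta -> b != beta ->
    let f := cubic (a + b + beta) (a * b + a * beta + b * beta) s in
  root f z -> ~~ root f^`() z.
Proof.
move=> sE ab abeta bbeta f; rewrite /root cubic_factor // deriv_cubic /cofac.
rewrite !mulf_eq0 !subr_eq0 !(hornerD, hornerN, hornerM, hornerC, hornerX, horner_exp).
move=> /orP[/orP[]|] /eqP <-.
- rewrite (_ : _ - _ = - ((a - b) * (a - beta))); last by ring.
  by rewrite oppr_eq0 mulf_neq0 // subr_eq0.
- rewrite (_ : _ - _ = (a - b) * (b - beta)); last by ring.
  by rewrite mulf_neq0 // subr_eq0.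
rewrite (_ : _ - _ = - ((a - beta) * (b - beta))); last by ring.
by rewrite oppr_eq0 mulf_neq0 // subr_eq0.
Qed.

Theorem corollary3p15 (R : realType) (a b beta : R) (hb : 0 < b) (hab : b < a)
    (hbeta : 0 < beta < b \/ b < beta < a)
    (P v : nat -> R * R) (htraj : magic_trajectory a b P v)
    (hcaustic : has_caustic a b beta P v)
    (n : nat) (hn : (0 < n)%N) :
  n_periodic n P v <->
  (~~ odd n /\ hankel_det (cayley_coef a b beta) 3 (n./2 - 1) = 0) \/
  (odd n /\ hankel_det (cayley_coef a b beta) 2 ((n - 1)./2) = 0).
Proof.
have a0 : 0 < a := lt_trans hb hab.
have beta0 : 0 < beta by case: hbeta => /andP[h ?] //; exact: lt_trans h.
have beta_a : beta != a.
  by case: hbeta => /andP[? h]; rewrite lt_eqF //; exact: lt_trans hab.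
have beta_b : beta != b by case: hbeta => /andP[? ?]; [rewrite lt_eqF|rewrite gt_eqF].
pose d i := offset (P i) (v i).
have norm i : (v i).1 ^+ 2 + (v i).2 ^+ 2 = 1.
  by have := velocity_norm hb hab htraj i; rewrite /dot -!expr2.
have dE i := offset_sqr hb hab beta_a beta_b htraj hcaustic i.
have [B [g [BE kE gk adm0]]] := exists_origin hb hab hbeta (norm 0%N) (dE 0%N).
set J := joachimsthal a b beta in kE gk adm0; set k := J * B in kE gk adm0.
have B0 : B != 0 by rewrite -sqrf_eq0 BE gt_eqF.
have caus i : on_caustic a B k (v i).1 (v i).2 (d i).
  by split=> //; rewrite BE kE; exact: dE.
have c0 : 0 < a - B ^+ 2 by rewrite BE subr_gt0.
have step i (adm : off_origin a B k g (v i).2 (d i)) :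
    [/\ off_origin a B k g (v i.+1).2 (d i.+1),
       line_absc a B k g (v i.+1).1 (v i.+1).2 (d i.+1) =
       line_absc a B k g (- (v i).1) (v i).2 (d i) &
       line_ord a B k g (v i.+1).1 (v i.+1).2 (d i.+1) =
       - line_ord a B k g (- (v i).1) (v i).2 (d i)].
  have [hQ hJ hJ' hoff htan] := bounce hb hab beta0 beta_a beta_b htraj hcaustic i.
  have aE : a != 0 by rewrite gt_eqF.
  pose x := (P i.+1).1; pose Y := (P i.+1).2 / B.
  have xE : (P i.+1).1 = x by [].
  have yE : (P i.+1).2 = B * Y by rewrite mulrC divfK.
  rewrite /on_ellipse /dot /ellipse_normal /offset xE yE /= in hQ hJ hJ' hoff htan.
  (* The Joachimsthal integral multiplied by [a * B]. *)
  have conic u : u.1 * (x / a) + u.2 * (B * Y / b) = J ->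
      B * u.1 * x + a * u.2 * Y = a * k.
    by move=> hu; rewrite /k -hu -BE; field; rewrite aE B0.
  apply: (line_step (x := x) (Y := Y) gk a0 c0 B0 _ (caus i) (caus i.+1) adm).
  - have -> : x ^+ 2 = a * (x ^+ 2 / a) by field.
    by congr (a * _); rewrite -hQ -BE; field; rewrite B0.
  - exact: conic.
  - by rewrite /d /offset -hoff; ring.
  - exact: conic.
  - by rewrite /d /offset xE yE; ring.
  - have aB : a * B != 0 by rewrite mulf_neq0.
    by rewrite -BE in htan; apply: (eq_lin (c := a * B) htan); field; rewrite aE B0.
have adm i : off_origin a B k g (v i).2 (d i).
  by elim: i => [//|i IH]; have [] := step i IH.
have den i := line_den_neq0 gk (caus i) c0 (adm i).
pose x i := line_absc a B k g (v i).1 (v i).2 (d i).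
pose y i := line_ord a B k g (v i).1 (v i).2 (d i).
pose m i := line_slope a B k g (v i).2 (d i).
pose s := a * B * k.
have sE : s ^+ 2 = a * b * beta by rewrite -BE -kE /s; ring.
have s0 : s != 0 by rewrite -sqrf_eq0 sE !mulf_neq0 // gt_eqF.
have yE i : y i = s + m i * x i by [].
have xS i : x i.+1 = line_absc a B k g (- (v i).1) (v i).2 (d i).
  by have [] := step i (adm i).
have yS i : y i.+1 = - (s + m i * x i.+1).
  by rewrite xS; have [] := step i (adm i).
have xadd i : x i + x i.+1 = sum1 a B k - m i ^+ 2 by rewrite xS line_abscN.
have xmul i : x i * x i.+1 = sum2 a B k + 2 * s * m i.
  by rewrite xS (line_abscM gk (caus i) (den i)).
pose f := cubic (sum1 a B k) (sum2 a B k) s.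
have fE : f = cubic (a + b + beta) (a * b + a * beta + b * beta) s.
  by rewrite /f /sum1 /sum2 BE kE.
have simple z : root f z -> ~~ root f^`() z.
  rewrite fE; apply: (cubic_simple_roots sE); rewrite // 1?eq_sym //.
  by rewrite lt_eqF.
case: n hn => // n _.
have taylor : 'X^(n.+1) %| (\poly_(i < n.+1) cayley_coef a b beta i) ^+ 2 - f.
  have F0 : 0 < f.[0] by rewrite fE cubic_factor // !subr0 !mulr_gt0.
  have := taylor_sqrt_sqr n.+1 F0.
  rewrite (_ : (fun z => _) = fun z => Num.sqrt ((a - z) * (b - z) * (beta - z))) //.
  by apply: funext => z; rewrite fE cubic_factor.
have closing : n_periodic n.+1 P v <-> x n.+1 = x 0%N /\ y n.+1 = y 0%N.
  apply: (iff_trans (periodic_iff hb hab beta0 beta_a beta_b htraj hcaustic (ltn0Sn n))).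
  split=> [[vE oE]|[xE yE']].
    by rewrite /x /y /d oE vE.
  (* The slope is recovered from y = s + m x, as the abscissa is nonzero. *)
  have mE : m n.+1 = m 0%N.
    have xn := absc_neq0 s0 yE yS n.
    apply: (mulIf xn); have := yE n.+1.
    by rewrite yE' yE xE => /addrI.
  have nz : g * (a - B ^+ 2) * (B ^+ 2 - a * k ^+ 2) * k != 0.
    have k0 : k != 0 by apply: contraNneq s0 => kz; rewrite /s kz mulr0.
    have g0 : g != 0.
      apply: contra_neq beta_a => gz.
      by rewrite -kE -[RHS]mulr1 -gk gz expr0n add0r.
    have e0 : B ^+ 2 - a * k ^+ 2 != 0 by rewrite BE kE subr_eq0 eq_sym.
    exact: (mulf_neq0 (mulf_neq0 (mulf_neq0 g0 (lt0r_neq0 c0)) e0) k0).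
  have [E1 E2 E3] := line_inj gk (caus n.+1) (caus 0%N) (den _) (den _) nz mE xE.
  by split=> //; apply: injective_projections.
apply: (iff_trans closing).
apply: (iff_trans (closing_iff_hankel simple s0 yE yS xadd xmul taylor)).
(* The period is now [n.+1], so [odd n] is the case of an even period. *)
rewrite /hankel_det /= negbK; case: (boolP (odd n)) => [on|en].
  rewrite uphalf_half on add1n subn1 /=.
  by split=> [?|[[]|[]]//]; left.
have -> : ((n.+1 - 1)./2 = n./2)%N by rewrite subn1.
by split=> [?|[[]|[]]//]; right.
Qed.
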